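(* For every $\lambda > 5.3646$, the hard-core model on $\mathbb{Z}^2$ with activity $\lambda$ admits more than one Gibbs state (i.e., there exist at least two distinct infinite-volume Gibbs measures).
   Context: The hard-core model with activity $\lambda>0$ on a finite graph $G$ is the probability distribution on the independent sets $I$ of $G$ given by $\mu(I)=\lambda^{|I|}/Z$, where $Z=\sum_{J}\lambda^{|J|}$ sums over all independent sets $J$ of $G$. A Gibbs state (Gibbs measure) for the hard-core model on $\mathbb{Z}^2$ with activity $\lambda$ is a probability measure on independent sets of $\mathbb{Z}^2$ such that for every finite set $\Lambda\subset\mathbb{Z}^2$, conditionally on the configuration outside $\Lambda$, the configuration inside $\Lambda$ is distributed proportionally to $\lambda^{|I\cap\Lambda|}$ over independent sets $I$ compatible with the outside configuration. *)

(* Defs.v *)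
From mathcomp Require Import all_boot all_order all_algebra finmap.
From mathcomp Require Import all_classical all_reals all_analysis.
Set Implicit Arguments.
Unset Strict Implicit.
Unset Printing Implicit Defensive.
Import Order.TTheory GRing.Theory Num.Theory.
Local Open Scope classical_set_scope.
Local Open Scope ring_scope.

Definition site : Type := (int * int)%type.

Definition neighbors (x y : site) : Prop :=
  `|x.1 - y.1| + `|x.2 - y.2| = 1 :> int.

Definition independent (I : set site) : Prop :=
  forall x y, I x -> I y -> ~ neighbors x y.

Definition occupied (x : site) : set (set site) := [set I | I x].

Definition config : Type := g_sigma_algebraType (range occupied).

Definition outside_event (L : {fset site}) : set (set config) :=
  <<s occupied @` (~` [set` L]) >>.

Definition weight (R : realType) (lambda : R) (L : {fset site})
    (I : set site) (J : {fset site}) : R :=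
  if `[< independent ([set` J] `|` (I `\` [set` L])) >]
  then lambda ^+ #|` J| else 0.

Definition partition_function (R : realType) (lambda : R) (L : {fset site})
    (I : set site) : R :=
  \sum_(J <- fpowerset L) weight lambda L I J.

(* The partition function vanishes only if [I] is not independent outside [L];
   since [0^-1 = 0] in [R], the specification is then identically zero. *)
Definition specification (R : realType) (lambda : R) (L : {fset site})
    (I : set site) (J : {fset site}) : R :=
  weight lambda L I J / partition_function lambda L I.

(* The integral identity says that [specification lambda L I J] is a version
   of the conditional probability of [I `&` L = J] given [I] outside [L]. *)
Definition gibbs_state (R : realType) (lambda : R)
    (mu : probability config R) : Prop :=
  mu [set I : config | independent I] = 1%E /\
  forall (L J : {fset site}) (A : set config),
    (J `<=` L)%fset -> outside_event L A ->
    mu (A `&` [set I : config | (I : set site) `&` [set` L] = [set` J]]) =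
    (\int[mu]_(I in A) (specification lambda L I J)%:E)%E.

(* Main.v *)
(* Peierls' argument. Fill the outside of a box with all the sites of parity [p], and suppose that
   a site of the other parity is occupied. It lies in a finite set [D] each of whose boundary
   edges goes from a vacant site of parity [p] inside to a vacant site of the other parity
   outside. Shifting the particles of [D] by one lattice step keeps the configuration independent
   and frees one site for each boundary edge of one of the four directions, which is a quarter of
   the boundary; these sites may be filled at will, so a contour of length [4 q] costs [(1 +
   lambda)^-q].

   A set [D] with the fewest boundary edges is bounded by a single dual circuit that visits no
   vertex twice, and it turns at every step because of the parities. The number of such walks of
   length [n] is [O(1.588^n)], by a finite certificate for the walks that close no polygon of
   length at most 24, and [1.588^4 < 6.3646 < 1 + lambda]. Asking that a long diagonal segment be
   occupied makes all contours long, and their total cost at most 1/2. Shifting also moves the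
   segment, so, in the limit with one boundary condition, one of two neighbouring segments is at
   most half as likely to be occupied as the other one, and it is the opposite with the other
   boundary condition.

   The limits are taken along an ultrafilter. They are finitely additive on cylinders, hence
   sigma-additive by compactness, and the DLR equations pass to the limit. *)

Require Import Defs.
From Stdlib Require Import NArith.
From HB Require Import structures.
From mathcomp Require Import all_boot all_order all_algebra finmap.
From mathcomp Require Import zify ring lra.
From mathcomp Require Import all_classical all_reals all_analysis.
From mathcomp Require Import measurable_realfun.
Set Implicit Arguments.
Unset Strict Implicit.
Unset Printing Implicit Defensive.
Import Order.TTheory GRing.Theory Num.Theory.
Import numFieldNormedType.Exports.
Local Open Scope classical_set_scope.
Local Open Scope ring_scope.

(** * Self-avoiding walks that turn at every step *)

(* [b] tells whether the step leaving [z] repeats or reverses the step from [x] to [y]; as successive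
   steps are perpendicular, a word describes a walk up to its first two steps. *)
Definition next_vertex (b : bool) (x y z : int * int) : int * int :=
  if b then z + (y - x) else z - (y - x).

Fixpoint trace (x y z : int * int) (w : seq bool) : seq (int * int) :=
  if w is b :: w' then x :: trace y z (next_vertex b x y z) w' else [:: x; y; z].

Definition saw (w : seq bool) : bool := uniq (trace (0, 0) (1, 0) (1, 1) w).

Fixpoint words (n : nat) : seq (seq bool) :=
  if n is n'.+1 then map (cons true) (words n') ++ map (cons false) (words n')
  else [:: [::]].

Lemma mem_words n w : (w \in words n) = (size w == n).
Proof.
have consI c : injective (cons c : seq bool -> seq bool) by move=> v w' [].
have consN c (s : seq (seq bool)) v : (~~ c :: v \in map (cons c) s) = false.
  by apply/mapP => -[u _ []]; case: c.
elim: n w => [|n IHn] [|b v] //=.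
  by rewrite mem_cat; apply/norP; split; apply/mapP => -[].
by rewrite eqSS mem_cat -IHn; case: b; rewrite mem_map ?(consN true) ?(consN false) ?orbF.
Qed.

Lemma trace_cons3 x y z w : exists s, trace x y z w = [:: x, y, z & s].
Proof.
elim: w x y z => [|b w IHw] x y z /=; first by exists [::].
by have [s ->] := IHw y z (next_vertex b x y z); exists (next_vertex b x y z :: s).
Qed.

Definition det (u v : int * int) : int := u.1 * v.2 - u.2 * v.1.

Definition affine (x u v p : int * int) : int * int :=
  (x.1 + p.1 * u.1 + p.2 * v.1, x.2 + p.1 * u.2 + p.2 * v.2).

Lemma affine_inj x u v : det u v != 0 -> injective (affine x u v).
Proof.
move=> uv0 [p1 p2] [q1 q2] [/= e1 e2].
have h1 : (p1 - q1) * det u v = 0.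
  have -> : (p1 - q1) * det u v =
      (x.1 + p1 * u.1 + p2 * v.1) * v.2 - (x.2 + p1 * u.2 + p2 * v.2) * v.1
      - ((x.1 + q1 * u.1 + q2 * v.1) * v.2 - (x.2 + q1 * u.2 + q2 * v.2) * v.1).
    by rewrite /det; ring.
  by rewrite e1 e2 subrr.
have h2 : (p2 - q2) * det u v = 0.
  have -> : (p2 - q2) * det u v =
      (x.2 + p1 * u.2 + p2 * v.2) * u.1 - (x.1 + p1 * u.1 + p2 * v.1) * u.2
      - ((x.2 + q1 * u.2 + q2 * v.2) * u.1 - (x.1 + q1 * u.1 + q2 * v.1) * u.2).
    by rewrite /det; ring.
  by rewrite e1 e2 subrr.
move/eqP: h1; move/eqP: h2; rewrite !mulf_eq0 (negPf uv0) !orbF !subr_eq0.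
by move=> /eqP-> /eqP->.
Qed.

Lemma trace_affine x u v p q r w :
  trace (affine x u v p) (affine x u v q) (affine x u v r) w =
  map (affine x u v) (trace p q r w).
Proof.
elim: w p q r => [|b w IHw] p q r //=; congr (_ :: _); rewrite -IHw.
by congr (trace _ _ _ _); case: b; rewrite /next_vertex /affine; congr pair => /=; ring.
Qed.

(** The affine map that sends (0, 0), (1, 0), (1, 1) to [x], [y], [z] carries one trace to the
    other, and it is injective when the first two steps are not parallel. *)
Lemma uniq_trace (x y z : int * int) w :
  det (y - x) (z - y) != 0 -> uniq (trace x y z w) = saw w.
Proof.
move=> d0; have ei := @affine_inj x _ _ d0.
have -> : trace x y z w = map (affine x (y - x) (z - y)) (trace (0,0) (1,0) (1,1) w).
  rewrite -trace_affine; congr (trace _ _ _ _);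
    by case: x y z {d0 ei} => [x1 x2] [y1 y2] [z1 z2]; congr pair => /=; ring.
by rewrite map_inj_uniq.
Qed.

Lemma trace_prefix x y z w v : prefix (trace x y z w) (trace x y z (w ++ v)).
Proof.
elim: w x y z => [|b w IHw] x y z /=; last by rewrite eqxx IHw.
by have [s ->] := trace_cons3 x y z v; rewrite /= !eqxx prefix0s.
Qed.

Lemma saw_prefix w v : saw (w ++ v) -> saw w.
Proof.
by rewrite /saw; have /prefixP[s ->] := trace_prefix (0,0) (1,0) (1,1) w v;
  rewrite cat_uniq => /andP[].
Qed.

Lemma saw_behead b w : saw (b :: w) -> saw w.
Proof.
rewrite {1}/saw /= => /andP[_]; rewrite uniq_trace //.
by case: b.
Qed.

Lemma saw_drop n w : saw w -> saw (drop n w).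
Proof. by elim: n w => [|n IHn] [|b w] //= /saw_behead /IHn. Qed.

(* Finite maps on words, read from the oldest letter. *)
Inductive trie := Nil | Leaf of N | Node of trie & trie.

Fixpoint lookup (t : trie) (w : seq bool) : N :=
  match t, w with
  | Leaf n, [::] => n
  | Node l r, b :: w' => lookup (if b then l else r) w'
  | _, _ => 0%num
  end.

(** [s] lists the visited vertices, newest first; a step back to one of them is pruned to [Nil],
    which is read as 0. For an upper bound on the number of walks, what matters is that no
    self-avoiding word is pruned. *)
Fixpoint saw_trie (n : nat) (s : seq (int * int)) : trie :=
  match n, s with
  | n'.+1, [:: z, y, x & _] =>
      let t b := let q := next_vertex b x y z in
                 if q \in s then Nil else saw_trie n' (q :: s) in
      Node (t true) (t false)
  | 0%N, _ => Leaf 1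
  | _, _ => Nil
  end.

Lemma lookup_saw_trie x y z s w :
  uniq (s ++ trace x y z w) ->
  lookup (saw_trie (size w) [:: z, y, x & s]) w = 1%num.
Proof.
elim: w x y z s => [|b w IHw] x y z s //= us.
have {}us : uniq ((x :: s) ++ trace y z (next_vertex b x y z) w).
  by rewrite -(perm_uniq (s1 := s ++ x :: trace y z (next_vertex b x y z) w)) //;
    apply/permPl/(perm_catCA s [:: x]).
have [r tr] := trace_cons3 y z (next_vertex b x y z) w.
have qs : next_vertex b x y z \notin [:: z, y, x & s].
  move: us; rewrite tr uniq_catC /= !inE !mem_cat !inE !negb_or.
  move=> /and4P[/and3P[_ yq _] /andP[zq _] /and3P[_ qx qs] _].
  by rewrite eq_sym zq eq_sym yq qx.
by case: b us tr qs => us tr /negPf -> ; apply: IHw.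
Qed.

Fixpoint collapse (n : nat) (m t : trie) : trie :=
  match n, m, t with
  | n'.+1, Node m1 m2, Node t1 t2 => Node (collapse n' m1 t1) (collapse n' m2 t2)
  | 0%N, Node m1 m2, Node t1 t2 =>
      Leaf (lookup m1 [::] * lookup t1 [::] + lookup m2 [::] * lookup t2 [::])
  | _, _, _ => Nil
  end.

Lemma lookup_collapse n m t w : size w = n ->
  lookup (collapse n m t) w =
  (lookup m (rcons w true) * lookup t (rcons w true) +
   lookup m (rcons w false) * lookup t (rcons w false))%num.
Proof.
elim: n m t w => [|n IHn] [|k|m1 m2] [|l|t1 t2] [|b w] //=; try by rewrite ?N.mul_0_r.
by move=> [wn]; case: b; apply: IHn.
Qed.

(* Appending a letter to the current word, one forgets its oldest letter: [m] says which extended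
   words are allowed. *)
Definition transfer (n : nat) (m t : trie) : trie :=
  if m is Node m1 m2 then Node (collapse n m1 t) (collapse n m2 t) else Nil.

Lemma lookup_transfer n m t c w : size w = n ->
  lookup (transfer n m t) (c :: w) =
  (lookup m (c :: rcons w true) * lookup t (rcons w true) +
   lookup m (c :: rcons w false) * lookup t (rcons w false))%num.
Proof. by case: m => [|k|m1 m2] //= wn; case: c; apply: lookup_collapse. Qed.

Fixpoint trie_add (t u : trie) : trie :=
  match t, u with
  | Node t1 t2, Node u1 u2 => Node (trie_add t1 u1) (trie_add t2 u2)
  | Leaf a, Leaf b => Leaf (a + b)
  | _, _ => Nil
  end.

Fixpoint trie_le (a b : N) (t u : trie) : bool :=
  match t, u with
  | Node t1 t2, Node u1 u2 => trie_le a b t1 u1 && trie_le a b t2 u2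
  | Leaf x, Leaf y => (a * x <=? b * y)%num
  | Nil, _ => true
  | _, _ => false
  end.

Lemma lookup_le a b t u w :
  trie_le a b t u -> (a * lookup t w <= b * lookup u w)%num.
Proof.
elim: t u w => [|x|t1 IH1 t2 IH2] [|y|u1 u2] [|c w] //=; rewrite ?N.mul_0_r //; try lia.
by move=> /andP[h1 h2]; case: c; [apply: IH1|apply: IH2].
Qed.

(** Started with [h = v], this gives [v + T v + ... + T^i v] for the transfer operator [T]. The sum
    serves as an approximate Perron eigenvector of [T]. *)
Fixpoint cumulate (i n : nat) (m v h : trie) : trie :=
  if i is i'.+1 then let v' := transfer n m v in cumulate i' n m v' (trie_add h v') else h.

(* The last three vertices, newest first, of a walk about to be extended. *)
Definition saw_start : seq (int * int) := [:: (1, 1); (1, 0); (0, 0)].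

(** A Collatz-Wielandt certificate: the transfer operator on words of [k + 1] letters multiplies [h]
    by at most 397/250 = 1.588, so the number of walks grows no faster. *)
Definition supersolution (k : nat) (h : seq bool -> nat) : Prop :=
  (forall w, size w = k.+1 -> saw w -> (0 < h w)%N) /\
  forall c w, size w = k ->
    (250 * (saw (c :: rcons w true) * h (rcons w true) +
            saw (c :: rcons w false) * h (rcons w false)) <= 397 * h (c :: w))%N.

Lemma trie_supersolution k t :
  trie_le 1 1 (saw_trie k.+1 saw_start) t ->
  trie_le 250 397 (transfer k (saw_trie k.+2 saw_start) t) t ->
  supersolution k (fun w => lookup t w).
Proof.
move=> le1 le2; split=> [w wk sw|c w wk].
  have := @lookup_le _ _ _ _ w le1.
  by rewrite -{1}wk (@lookup_saw_trie _ _ _ [::]) //; lia.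
have := @lookup_le _ _ _ _ (c :: w) le2; rewrite lookup_transfer //.
have sawE b : saw (c :: rcons w b) ->
    lookup (saw_trie k.+2 saw_start) (c :: rcons w b) = 1%num.
  have <- : size (c :: rcons w b) = k.+2 by rewrite /= size_rcons wk.
  exact: (@lookup_saw_trie _ _ _ [::]).
by do 2![case: (boolP (saw _)) => [/sawE ->|_]]; lia.
Qed.

Definition extensions (n : nat) (w : seq bool) : nat :=
  count (fun u => saw (w ++ u)) (words n).

Lemma extensionsS n w :
  extensions n.+1 w = (extensions n (rcons w true) + extensions n (rcons w false))%N.
Proof.
rewrite /extensions /= count_cat !count_map.
by congr addn; apply: eq_count => u; rewrite /= cat_rcons.
Qed.

(** Only the last [k + 1] letters are remembered. Each new letter multiplies the total of [h] over
    the extensions by at most 397/250, and [h] is at least 1 on the words that survive to the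
    end. *)
Lemma extensions_leq k h n u c w : supersolution k h -> size w = k ->
  (250 ^ n * extensions n (u ++ c :: w) <=
   397 ^ n * (saw (u ++ c :: w) * h (c :: w)))%N.
Proof.
move=> [h_pos h_step] ws; elim: n u c w ws => [|n IHn] u c w ws.
  rewrite !expn0 !mul1n /extensions /= cats0 addn0.
  case: (boolP (saw _)) => // /(saw_drop (size u)); rewrite drop_size_cat // mul1n.
  by apply: h_pos; rewrite /= ws.
have bound b : (250 ^ n * extensions n (rcons (u ++ c :: w) b) <=
    397 ^ n * (saw (u ++ c :: w) * (saw (c :: rcons w b) * h (rcons w b))))%N.
  case wb: (rcons w b) => [|d v]; first by case: (w) wb.
  have vk : size v = k by move/(congr1 size): wb; rewrite size_rcons ws => -[].
  have := IHn (rcons u c) d v vk; rewrite cat_rcons -wb -rcons_cons -rcons_cat.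
  move/leq_trans; apply; rewrite leq_mul2l mulnA; apply/orP; right.
  apply: leq_mul => //; rewrite mulnb; case: (boolP (saw (rcons _ _))) => // sb.
  have -> : saw (u ++ c :: w) by move: sb; rewrite -cats1 => /saw_prefix.
  have -> // : saw (rcons (c :: w) b).
  by have := saw_drop (size u) sb; rewrite rcons_cat drop_size_cat.
have := h_step c _ ws.
rewrite extensionsS !expnS; move: (bound true) (bound false).
set A := (250 ^ n)%N; set B := (397 ^ n)%N; case: (saw (u ++ _)); nia.
Qed.

(** A word too short for [h] is split according to its next letter until it has [k + 1] letters. *)
Lemma extensions_bounded k h w : supersolution k h -> (size w <= k.+1)%N ->
  exists C, forall n, (250 ^ n * extensions n w <= 397 ^ n * C)%N.
Proof.
move=> hS wk; have [j] := ubnP (k.+1 - size w); elim: j w wk => // j IHj w wk wj.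
have [w_eq|w_lt] := eqVneq (size w) k.+1.
  case: w w_eq {wk wj} => // c w [ws]; exists (h (c :: w)) => n.
  apply: leq_trans (extensions_leq n [::] c hS ws) _.
  by rewrite leq_mul2l; case: (saw _); rewrite ?mul1n ?leqnn ?orbT.
have [C1 h1] : exists C, forall n, (250 ^ n * extensions n (rcons w true) <= 397 ^ n * C)%N.
  by apply: IHj; rewrite size_rcons; lia.
have [C2 h2] : exists C, forall n, (250 ^ n * extensions n (rcons w false) <= 397 ^ n * C)%N.
  by apply: IHj; rewrite size_rcons; lia.
exists (1 + C1 + C2)%N => -[|n].
  by rewrite /extensions /= ; case: saw; lia.
rewrite extensionsS !expnS; move: (h1 n) (h2 n).
set A := (250 ^ n)%N; set B := (397 ^ n)%N; nia.
Qed.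

(* [t] counts the extensions by at most [n] steps. *)
Definition supersolution_check (k n : nat) : bool :=
  let v := saw_trie k.+1 saw_start in
  let m := saw_trie k.+2 saw_start in
  let t := cumulate n k m v v in
  trie_le 1 1 v t && trie_le 250 397 (transfer k m t) t.

Lemma supersolution_checkP k n : supersolution_check k n -> exists h, supersolution k h.
Proof.
move=> /andP[le1 le2]; eexists; exact: trie_supersolution le1 le2.
Qed.

(* The extended words have 22 letters, hence 24 steps: the only constraint kept is that the walk
   closes no polygon of length at most 24. *)
Lemma supersolution_20_27 : supersolution_check 20 27.
Proof. by vm_compute. Qed.

Lemma saw_count :
  exists C, forall n, (250 ^ n * count saw (words n) <= 397 ^ n * C)%N.
Proof. by have [h hS] := supersolution_checkP supersolution_20_27;
  apply: (extensions_bounded (w := [::]) hS). Qed.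

(** * Dual edges and winding numbers *)

Definition dirs : seq site := [:: (1, 0); (0, 1); (-1, 0); (0, -1)].
Definition rotl (d : site) : site := (- d.2, d.1).
Definition parity (x : site) : bool := odd `|x.1 + x.2|.

Lemma dirsP (P : site -> Prop) :
  P (1, 0) -> P (0, 1) -> P (-1, 0) -> P (0, -1) -> forall d, d \in dirs -> P d.
Proof. by move=> h1 h2 h3 h4 d; rewrite !inE => /or4P[] /eqP->. Qed.

Lemma rotl_dirs d : d \in dirs -> rotl d \in dirs.
Proof. by move: d; apply: dirsP. Qed.

Lemma opp_dirs d : d \in dirs -> - d \in dirs.
Proof. by move: d; apply: dirsP. Qed.

Lemma rotlK d : rotl (rotl d) = - d.
Proof. by case: d. Qed.

Lemma rotlN d : rotl (- d) = - rotl d.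
Proof. by case: d. Qed.

Lemma parity_dir x d : d \in dirs -> parity (x + d) = ~~ parity x.
Proof.
by case: x => x1 x2; move: d; apply: dirsP; rewrite /parity /=; lia.
Qed.

(* An oriented dual edge [(s, d)] points in direction [d], with the site [s] on its left and
   [s - rotl d] on its right.  Corners of the dual lattice have doubled coordinates, the site
   [s] being at [2 s]. *)
Definition edge_tail (e : site * site) : site := e.1 *+ 2 - rotl e.2 - e.2.
Definition edge_head (e : site * site) : site := e.1 *+ 2 - rotl e.2 + e.2.

(* Signed crossing of the half-line going right from [x]. *)
Definition crossing (x : site) (e : site * site) : int :=
  e.2.2 *+ ((e.1.2 *+ 2 - e.2.1 == x.2 *+ 2) && (x.1 *+ 2 < e.1.1 *+ 2 + e.2.2)).

(** The half-lines from [x] and [x + (1, 0)] differ by a segment that only the two orientations of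
    the edge between these sites can cross. *)
Lemma crossing_right x e : e.2 \in dirs ->
  crossing x e - crossing (x + (1, 0)) e =
  (e == (x, (0, 1)))%:Z - (e == (x + (1, 0), (0, -1)))%:Z.
Proof.
case: e x => [[s1 s2] d] [x1 x2] /=; move: d.
by apply: dirsP; rewrite /crossing !xpair_eqE /=; lia.
Qed.

Definition below (x c : site) : int :=
  ((x.1 *+ 2 < c.1) && (c.2 == x.2 *+ 2 - 1))%:Z.

(** The strip between the two half-lines, whose corners [below] marks, can be entered or left only
    through one of them, or at its left end along the edge that separates the two sites. *)
Lemma crossing_up x e : e.2 \in dirs ->
  crossing x e - crossing (x - (0, 1)) e =
  (e == (x, (1, 0)))%:Z - (e == (x - (0, 1), (-1, 0)))%:Z
  + (below x (edge_tail e) - below x (edge_head e)).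
Proof.
case: e x => [[s1 s2] d] [x1 x2] /=; move: d.
by apply: dirsP; rewrite /crossing /below /edge_tail /edge_head !xpair_eqE /=; lia.
Qed.

Definition winding (S : seq (site * site)) (x : site) : int :=
  \sum_(e <- S) crossing x e.

(** Closed in the sense of chains: each corner is left as often as it is reached. Several components
    and multiple visits to a corner are allowed. *)
Definition circuit (S : seq (site * site)) : Prop :=
  [/\ uniq S, {in S, forall e, e.2 \in dirs} & perm_eq (map edge_tail S) (map edge_head S)].

Lemma circuit_sum (S : seq (site * site)) (F : site -> int) :
  circuit S -> \sum_(e <- S) (F (edge_tail e) - F (edge_head e)) = 0.
Proof.
move=> [_ _ th]; rewrite sumrB -(big_map edge_tail xpredT F) -(big_map edge_head xpredT F).
by rewrite (perm_big _ th) subrr.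
Qed.

Lemma sum_eq_op (S : seq (site * site)) e0 : uniq S ->
  \sum_(e <- S) (e == e0)%:Z = (e0 \in S)%:Z.
Proof.
elim: S => [|e S IHS] /=; first by rewrite big_nil.
move=> /andP[eS /IHS uS]; rewrite big_cons uS inE eq_sym.
by case: eqVneq => [->|_]; rewrite ?(negPf eS) ?addr0 ?add0r.
Qed.

(** The two lemmas on crossings treat vertical and horizontal edges, the terms in [below] cancelling
    along a circuit. Reversing [d] exchanges the two sides. *)
Lemma winding_jump S x d : circuit S -> d \in dirs ->
  winding S x - winding S (x - rotl d) =
  ((x, d) \in S)%:Z - ((x - rotl d, - d) \in S)%:Z.
Proof.
move=> cS; have [uS dS _] := cS.
have jump_right y : winding S y - winding S (y + (1, 0)) =
    ((y, (0, 1)) \in S)%:Z - ((y + (1, 0), (0, -1)) \in S)%:Z.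
  rewrite -!(sum_eq_op _ uS) /winding -!sumrB.
  by refine (eq_big_seq _ _) => e /dS /crossing_right.
have jump_up y : winding S y - winding S (y - (0, 1)) =
    ((y, (1, 0)) \in S)%:Z - ((y - (0, 1), (-1, 0)) \in S)%:Z.
  rewrite -[RHS]addr0 -[X in _ = _ + X](circuit_sum (below y) cS) -!(sum_eq_op _ uS).
  rewrite /winding -!sumrB -big_split /=.
  by refine (eq_big_seq _ _) => e /dS /crossing_up.
have addK (u v : site) : u - v + v = u by rewrite subrK.
move: d; apply: dirsP; rewrite /rotl /=.
- exact: jump_up.
- by have := jump_right x; congr (_ - winding S _ = _ - (_ \in S)%:Z);
    case: x => x1 x2; congr pair => //=; congr pair; rewrite /=; lia.
- have := jump_up (x + (0, 1)); rewrite addrK.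
  have -> : x - (- 0, -1) = x + (0, 1) by case: x => x1 x2; congr pair => /=; lia.
  have -> : - (-1, 0) = (1, 0) :> site by [].
  by move=> jump; rewrite -[LHS]opprB jump opprB.
- have := jump_right (x - (1, 0)); rewrite subrK.
  have -> : x - (- -1, 0) = x - (1, 0) by case: x => x1 x2; congr pair => /=; lia.
  have -> : - (0, -1) = (0, 1) :> site by [].
  by move=> jump; rewrite -[LHS]opprB jump opprB.
Qed.

Definition in_box (N : nat) (x : site) : bool := (`|x.1| <= N)%N && (`|x.2| <= N)%N.

Lemma winding_support S N x : circuit S ->
  {in S, forall e, in_box N e.1} -> winding S x != 0 -> in_box N.+1 x.
Proof.
move=> cS bS; have [uS dS _] := cS; apply: contraR => xN; apply/eqP.
have [x2N|x2N] := leqP `|x.2| N.+1; last first.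
  rewrite /winding big_seq big1 // => e eS; have := bS e eS; have := dS e eS.
  case: e x xN x2N {eS} => [[s1 s2] d] [x1 x2] /= xN x2N; rewrite /in_box /crossing /= in xN *.
  by move: d; apply: dirsP => /=; lia.
have [x1N|x1N] := ltP 0 x.1.
  rewrite /winding big_seq big1 // => e eS; have := bS e eS; have := dS e eS.
  case: e x xN x2N x1N {eS} => [[s1 s2] d] [x1 x2] /= xN x2N x1N;
    rewrite /in_box /crossing /= in xN *.
  by move: d; apply: dirsP => /=; lia.
(* To the left of the box, the half-line crosses the same edges of [S] as the whole line, and a
   circuit goes up through a line as often as down. *)
rewrite /winding -[RHS](circuit_sum (fun c => - Posz (x.2 *+ 2 < c.2)%R) cS).
refine (eq_big_seq _ _) => e eS; have := bS e eS; have := dS e eS.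
case: e x xN x2N x1N {eS} => [[s1 s2] d] [x1 x2] /= xN x2N x1N.
rewrite /in_box /crossing /edge_tail /edge_head /= in xN *.
by move: d; apply: dirsP => /=; lia.
Qed.

(** * Boxes and boundaries of finite sets of sites *)

Definition range_int (N : nat) : seq int := [seq k%:Z - N%:Z | k <- iota 0 N.*2.+1].

Definition box (N : nat) : {fset site} :=
  [fset x in [seq (i, j) | i <- range_int N, j <- range_int N]]%fset.

Lemma mem_box N x : (x \in box N) = in_box N x.
Proof.
have mem_range (i : int) : (i \in range_int N) = (`|i| <= N)%N.
  apply/mapP/idP => [[k]|iN]; first by rewrite mem_iota => ? ->; lia.
  by exists `|(i + N%:Z)%R|%N; [rewrite mem_iota|]; lia.
case: x => i j; rewrite /box in_fset /in_box -!mem_range.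
apply/allpairsP/andP => [[[k l] [/= ? ? [-> ->]]] //|[iN jN]].
by exists (i, j).
Qed.

Lemma fset_in_box (D : {fset site}) : exists N, {in D, forall x, in_box N x}.
Proof.
exists (\max_(x <- D) (maxn `|x.1| `|x.2|)) => x xD.
by rewrite /in_box -geq_max; exact: (@leq_bigmax_seq _ _ xpredT (fun x : site => maxn `|x.1|
  `|x.2|) x xD isT).
Qed.

Definition edges (D : {fset site}) : seq (site * site) :=
  [seq e <- [seq (s, d) | s <- D, d <- dirs] | e.1 - rotl e.2 \notin D].

Lemma mem_edges D e :
  (e \in edges D) = [&& e.1 \in D, e.2 \in dirs & e.1 - rotl e.2 \notin D].
Proof.
case: e => s d; have memE : ((s, d) \in [seq (s, d) | s <- D,
  d <- dirs]) = (s \in D) && (d \in dirs).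
  apply/allpairsP/andP => [[[k l] [kD ld [-> ->]]] //|[sD dd]].
  by exists (s, d).
by rewrite mem_filter memE andbC andbA.
Qed.

Lemma uniq_edges D : uniq (edges D).
Proof. by apply: filter_uniq; apply: allpairs_uniq => // -[? ?] [? ?]. Qed.

(** Go right from a site [x] of [D] until the first exit. The edge crossed there is also a boundary
    edge of [D'], so the last site before it is in [D']; on the way back no boundary edge is met, so
    [x] is in [D']. *)
Lemma edges_inj D1 D2 : edges D1 =i edges D2 -> D1 = D2.
Proof.
suff sub D D' : edges D =i edges D' -> (D `<=` D')%fset.
  by move=> e12; apply/eqP; rewrite eqEfsubset !sub // => e; rewrite e12.
move=> eD; apply/fsubsetP => x xD; have [N DN] := fset_in_box D.
pose y k : site := x + (k%:Z, 0).
have yS k : y k.+1 = y k + (1, 0).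
  by rewrite /y -addrA; congr (_ + _); congr pair; rewrite /=; lia.
have : exists k, y k \notin D.
  exists (N + `|x.1|).+1; apply/negP => /DN; rewrite /in_box /y.
  by case: (x) => x1 x2 /=; lia.
case/ex_minnP => -[|k]; first by rewrite /y addr0 xD.
rewrite yS => ykD kmin.
have yD j : (j <= k)%N -> y j \in D.
  by move=> jk; apply/negPn/negP => /kmin; lia.
suff main j : (j <= k)%N -> y (k - j)%N \in D' by have := main k (leqnn _); rewrite subnn /y addr0.
have rU u : u - rotl (0, 1) = u + (1, 0) by rewrite -[(1, 0)]opprK.
have rD u : u - rotl (0, -1) = u - (1, 0) by [].
elim: j => [_|j IHj jk].
  have : (y k, (0, 1)) \in edges D' by rewrite -eD mem_edges rU yD.
  by rewrite mem_edges subn0 => /and3P[].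
have {}IHj := IHj (ltnW jk); have yj : y (k - j)%N = y (k - j.+1)%N + (1, 0).
  by rewrite -yS -subSn.
apply/negPn/negP => yD'; have : (y (k - j)%N, (0, -1)) \in edges D'.
  by rewrite mem_edges IHj rD yj addrK.
by rewrite -eD mem_edges rD yj addrK yD ?leq_subr // !andbF.
Qed.

Definition border (p : bool) (D : {fset site}) : Prop :=
  {in edges D, forall e, parity e.1 = p}.

Definition irreducible (D : {fset site}) : Prop :=
  forall S, circuit S -> (0 < size S)%N -> {subset S <= edges D} -> {subset edges D <= S}.

Definition vacant (I : set site) (D : {fset site}) : Prop :=
  {in edges D, forall e, ~ I e.1 /\ ~ I (e.1 - rotl e.2)}.

Definition diag (a : site) (i : nat) : site := a + (i%:Z, i%:Z).

(** Boundary edges have vacant sites on both sides, so [S] does not pass between an occupied site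
    and its neighbours. *)
Lemma vacant_winding I D S x d : circuit S -> {subset S <= edges D} -> vacant I D -> I x ->
  d \in dirs -> winding S (x - rotl d) = winding S x.
Proof.
move=> cS SD vD Ix dd; have := winding_jump x cS dd.
case: (boolP (_ \in S)) => [/SD /vD [] //|_].
case: (boolP (_ \in S)) => [/SD /vD [_] /=|_].
  by rewrite rotlN opprK subrK.
by move/eqP; rewrite subr0 subr_eq0 => /eqP.
Qed.

(** This is the common neighbour of two successive sites of the diagonal; through it the winding
    number is carried from one to the other. *)
Lemma diag_step a i : diag a i - rotl (0, 1) = diag a i.+1 - rotl (1, 0).
Proof. by case: a => a1 a2; rewrite /diag /rotl; congr pair => /=; lia. Qed.

(* Take [D] with the fewest boundary edges.  The segment is occupied, so no circuit [S] of boundary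
   edges separates it.  If [S] winds positively around it, the set where [winding S > 0] has all its
   boundary in [S]; otherwise removing the winding of [S] from the indicator of [D] leaves a set
   whose boundary avoids [S].  Minimality gives [S = edges D] in the first case and excludes the
   second one. *)
Lemma irreducible_exists (I : set site) p D0 a m :
  (forall i, (i < m.+1)%N -> I (diag a i)) ->
  (forall i, (i < m.+1)%N -> diag a i \in D0) -> border p D0 -> vacant I D0 ->
  exists D, [/\ forall i, (i < m.+1)%N -> diag a i \in D, border p D, vacant I D & irreducible D].
Proof.
move=> Idiag diag0 bD0 vD0.
pose good n := `[< exists D, [/\ forall i, (i < m.+1)%N -> diag a i \in D, border p D,
  vacant I D & size (edges D) = n] >].
have : exists n, good n by exists (size (edges D0)); apply/asboolP; exists D0.
case/ex_minnP => n /asboolP[D [diagD bD vD Dn]] nmin.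
have {}nmin E : (forall i, (i < m.+1)%N -> diag a i \in E) -> {subset edges E <= edges D} ->
    (n <= size (edges E))%N.
  move=> diagE ED; apply: nmin; apply/asboolP; exists E; split=> // e /ED; [exact: bD|exact: vD].
exists D; split=> // S cS S0 SD; have [uS dS _] := cS.
have wdiag i : (i < m.+1)%N -> winding S (diag a i) = winding S a.
  elim: i => [|i IHi im]; first by rewrite /diag addr0.
  have wl := vacant_winding cS SD vD (d := (0, 1)) (Idiag i (ltnW im)) isT.
  have wr := vacant_winding cS SD vD (d := (1, 0)) (Idiag _ im) isT.
  apply: etrans (esym wr) _; apply: etrans (etrans _ wl) (IHi (ltnW im)).
  by rewrite diag_step.
have [B supp] : exists B : {fset site}, forall x, winding S x != 0 -> x \in B.
  have [N DN] := fset_in_box D; exists (box N.+1) => x.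
  rewrite mem_box; apply: winding_support => // e /SD.
  by rewrite mem_edges => /and3P[/DN].
have [wa|wa] := ltP 0 (winding S a).
  pose E := [fset x in B | 0 < winding S x]%fset.
  have memE x : (x \in E) = (0 < winding S x).
    rewrite /E !inE andb_idl // => wx; apply: supp; lia.
  have ES : {subset edges E <= S}.
    move=> [s d]; rewrite mem_edges !memE /= => /and3P[s1 dd s2].
    have := winding_jump s cS dd; case: (boolP (_ \in S)) => // _.
    by case: (_ \in S) => /=; lia.
  have szS : (size (edges D) <= size S)%N.
    apply: leq_trans (uniq_leq_size (uniq_edges E) ES); rewrite Dn;
      apply: nmin => [i im|e /ES /SD //].
    by rewrite memE wdiag.
  by have [_ SE] := uniq_min_size uS SD szS; move=> e; rewrite SE.
pose E := [fset x in D `|` B | winding S x < (x \in D)%:Z]%fset.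
have memE x : (x \in E) = (winding S x < (x \in D)%:Z).
  rewrite /E !inE andb_idl //; case: (x \in D) => //= wx; apply: supp; lia.
(* Across an edge of [S] the indicator of [D] and the winding number jump together, so their
   difference does not change and the edge leaves the boundary. *)
have ED : {subset edges E <= [seq e <- edges D | e \notin S]}.
  move=> [s d]; rewrite mem_filter !mem_edges !memE /= => /and3P[s1 dd s2].
  have := winding_jump s cS dd.
  have hS : ((s, d) \in S) -> (s \in D) && (s - rotl d \notin D).
    by move/SD; rewrite mem_edges => /and3P[/= -> _ ->].
  have hS' : ((s - rotl d, - d) \in S) -> (s - rotl d \in D) && (s \notin D).
    by move/SD; rewrite mem_edges /= rotlN opprK subrK => /and3P[/= -> _ ->].
  move: hS hS' s1 s2; rewrite dd.
  case: ((s, d) \in S); case: ((s - rotl d, - d) \in S); case: (s \in D);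
    case: (s - rotl d \in D) => //= h1 h2;
   try (by have := h1 isT); try (by have := h2 isT); by lia.
have : (n <= size (edges E))%N.
  apply: nmin => [i im|e /ED]; last by rewrite mem_filter => /andP[].
  by rewrite memE wdiag // diagD //; lia.
move/leq_trans => /(_ _ (uniq_leq_size (uniq_edges E) ED)).
rewrite size_filter -Dn -(count_predC (mem S) (edges D)) -[X in (_ <= X)%N]add0n leq_add2r.
rewrite leqn0 -leqn0 leqNgt -has_count => /hasPn nS.
by case: (S) S0 SD nS => // e S' _ /(_ e (mem_head _ _)) eD /(_ e eD); rewrite /= mem_head.
Qed.

(** * Irreducible contours *)

Definition turn (D : {fset site}) (e : site * site) : site * site :=
  if e.1 + e.2 \in D then (e.1 - rotl e.2 + e.2, - rotl e.2) else (e.1, rotl e.2).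

(** The site ahead on the left decides the turn. If it is in [D], so is the site ahead on the right:
    otherwise the boundary would go straight along two neighbouring inner sites, which have opposite
    parities. *)
Lemma turn_edge p D e : border p D -> e \in edges D -> turn D e \in edges D.
Proof.
case: e => s d bD eD; have /and3P[/= sD dd tD] : [&& (s, d).1 \in D, (s, d).2 \in dirs & (s,
  d).1 - rotl (s, d).2 \notin D].
  by rewrite -mem_edges.
rewrite /turn /=; case: ifPn => sdD; last first.
  by rewrite mem_edges /= sD rotl_dirs // rotlK opprK.
rewrite mem_edges /= opp_dirs ?rotl_dirs //= rotlN rotlK !opprK addrK tD andbT.
apply/negPn/negP => udD; have : (s + d, d) \in edges D.
  by rewrite mem_edges /= sdD dd addrAC.
move/bD; rewrite /= parity_dir //; have /bD := eD => /= ->; by case: (p).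
Qed.

Lemma turn_tail D e : edge_tail (turn D e) = edge_head e.
Proof.
case: e => s d; rewrite /turn /edge_tail /edge_head /=; case: ifP => _ /=.
  by rewrite rotlN rotlK !opprK mulrnDl mulrnBl !mulr2n; case: s d => s1 s2 [d1 d2];
    congr pair => /=; lia.
by rewrite rotlK opprK; case: s d => s1 s2 [d1 d2]; congr pair => /=; lia.
Qed.

Lemma turn_dir D e : (turn D e).2 = rotl e.2 \/ (turn D e).2 = - rotl e.2.
Proof. by rewrite /turn; case: ifP; [right|left]. Qed.

Section Orbit.
Variables (p : bool) (D : {fset site}) (e0 : site * site).
Hypotheses (bD : border p D) (e0D : e0 \in edges D).

Definition walk_edge i := iter i (turn D) e0.
Definition walk_corner i := edge_tail (walk_edge i).

Lemma walk_edge_in i : walk_edge i \in edges D.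
Proof. by elim: i => [|i IHi]; [exact: e0D | exact: turn_edge bD IHi]. Qed.

Lemma walk_head i : edge_head (walk_edge i) = walk_corner i.+1.
Proof. by rewrite /walk_corner /= turn_tail. Qed.

Lemma walk_cornerS i : walk_corner i.+1 = walk_corner i + (walk_edge i).2 *+ 2.
Proof. by rewrite -walk_head /walk_corner /edge_head /edge_tail mulr2n addrA subrK. Qed.

Lemma trace_walk i n : exists2 w, size w = n &
  [seq walk_corner j | j <- iota i n.+3] =
    trace (walk_corner i) (walk_corner i.+1) (walk_corner i.+2) w.
Proof.
elim: n i => [|n IHn] i; first by exists [::].
have [w wn tw] := IHn i.+1.
have [b nb] : exists b, walk_corner i.+3 =
  next_vertex b (walk_corner i) (walk_corner i.+1) (walk_corner i.+2).
  have d2 : (walk_edge i.+2).2 = (walk_edge i).2 \/ (walk_edge i.+2).2 = - (walk_edge i).2.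
    have := turn_dir D (walk_edge i.+1); have := turn_dir D (walk_edge i).
    rewrite -!/(walk_edge _.+1) => -[->|->] [->|->]; rewrite ?rotlN rotlK ?opprK; by [left|right].
  case: d2 => d2; [exists true|exists false];
    rewrite /next_vertex (walk_cornerS i.+2) d2 (walk_cornerS i).
    by rewrite [walk_corner i + _]addrC addrK.
  by rewrite [walk_corner i + _]addrC addrK mulNrn.
by exists (b :: w); rewrite /= ?wn // -nb -tw.
Qed.
End Orbit.

Lemma tail_head_inj e e' : e.2 \in dirs -> e'.2 \in dirs ->
  edge_tail e = edge_tail e' -> edge_head e = edge_head e' -> e = e'.
Proof.
case: e e' => [[s1 s2] d] [[t1 t2] c] /=; move: d; apply: dirsP; move: c; apply: dirsP;
  rewrite /edge_tail /edge_head /= => -[? ?] [? ?]; by [exfalso; lia | congr pair; congr pair; lia].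
Qed.

Definition closed_edges (C : seq site) : seq (site * site) := zip C (rot 1 C).

(** Follow the boundary until a corner is repeated for the first time. The loop just closed is a
    circuit, so by irreducibility it contains all the edges; in particular it contains the first
    one, so the walk closes at its starting corner. *)
Lemma irreducible_cycle p D e0 : border p D -> irreducible D -> e0 \in edges D ->
  exists n, [/\ perm_eq (edges D) [seq walk_edge D e0 i | i <- iota 0 n],
    uniq [seq walk_corner D e0 i | i <- iota 0 n] & walk_corner D e0 n = walk_corner D e0 0%N].
Proof.
move=> bD iD e0D; pose E := walk_edge D e0; pose c := walk_corner D e0.
have ED i : E i \in edges D by apply: walk_edge_in bD e0D i.
have : exists n, ~~ uniq [seq c i | i <- iota 0 n].
  exists (size (edges D)).+1; apply/negP => uc.
  have uE : uniq [seq E i | i <- iota 0 (size (edges D)).+1].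
    by apply: (@map_uniq _ _ edge_tail); rewrite -map_comp.
  have : {subset [seq E i | i <- iota 0 (size (edges D)).+1] <= edges D}.
    by move=> _ /mapP[i _ ->].
  by move/(uniq_leq_size uE); rewrite size_map size_iota ltnn.
case/ex_minnP => -[//|n] nuc nmin.
have uc : uniq [seq c i | i <- iota 0 n].
  by apply/negPn/negP => /nmin; rewrite ltnn.
move: nuc; rewrite -[n.+1]addn1 iotaD map_cat cat_uniq uc /= orbF andbT negbK add0n.
case/mapP => i; rewrite mem_iota /= add0n => ltin cin.
pose S := [seq E j | j <- iota i (n - i)].
have tS : [seq edge_tail e | e <- S] = [seq c j | j <- iota i (n - i)] by rewrite -map_comp.
have sub_iota : subseq (iota i (n - i)) (iota 0 n).
  by rewrite -{2}(subnKC (ltnW ltin)) iotaD add0n suffix_subseq.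
have uS : uniq [seq edge_tail e | e <- S] by rewrite tS (subseq_uniq (map_subseq _ sub_iota)).
have cS : circuit S.
  split; [exact: map_uniq uS| |].
    by move=> _ /mapP[j _ ->]; have := ED j; rewrite mem_edges => /and3P[].
  have -> : [seq edge_head e | e <- S] = [seq c j | j <- iota i.+1 (n - i)].
    rewrite -map_comp -[i.+1]add1n iotaDl -map_comp; apply: eq_map => j.
    by rewrite /= walk_head.
  rewrite tS; have [k kE] : exists k, (n - i)%N = k.+1 by exists (n - i).-1; lia.
  rewrite kE -{2}[k.+1]addn1 iotaD map_cat /=.
  have -> : (i.+1 + k)%N = n by lia.
  by rewrite cin -cat1s perm_catC.
have S0 : (0 < size S)%N by rewrite size_map size_iota subn_gt0.
have SD : {subset S <= edges D} by move=> _ /mapP[j _ ->].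
have DS := iD S cS S0 SD.
have i0 : i = 0%N.
  have : c 0%N \in [seq edge_tail e | e <- S] by apply: map_f; apply: DS.
  rewrite tS => c0S; apply/eqP; rewrite -leqn0 leqNgt; apply/negP => i0.
  move: uc; rewrite -(subnKC (ltnW ltin)) iotaD add0n map_cat cat_uniq => /and3P[_ /hasPn nc _].
  by have := nc _ c0S; case: (i) i0 => //= k _; rewrite mem_head.
have SE : S = [seq E j | j <- iota 0 n] by rewrite /S i0 subn0.
exists n; split=> //; last by rewrite -/c cin i0.
rewrite -SE; apply: uniq_perm; [exact: uniq_edges|exact: map_uniq uS|].
by move=> e; apply/idP/idP => [/DS|/SD].
Qed.

Lemma rot_map_iota (c : nat -> site) n : c n = c 0%N ->
  rot 1 [seq c i | i <- iota 0 n] = [seq c i.+1 | i <- iota 0 n].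
Proof.
case: n => [|n] // cn; transitivity [seq c i | i <- iota 1 n.+1].
  have -> : iota 1 n.+1 = rcons (iota 1 n) n.+1 by rewrite -{1}[n.+1]addn1 iotaD cats1 add1n.
  by rewrite map_rcons cn /= rot1_cons.
by rewrite (iotaDl 1 0) -map_comp.
Qed.

Lemma sum_count (T : Type) (P : pred T) (S : seq T) :
  \sum_(e <- S) (P e)%:Z = (count P S)%:Z.
Proof. by elim: S => [|e S IHS]; rewrite ?big_nil // big_cons IHS. Qed.

Lemma count_parity b m : count (fun i => odd i (+) b) (iota 0 m.*2) = m.
Proof.
elim: m => // m IHm; rewrite doubleS -addn2 iotaD count_cat IHm /= !add0n odd_double.
by move: b {IHm} => [] /=; rewrite ?addn1.
Qed.

Definition count_dir (D : {fset site}) (d : site) : nat :=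
  count (fun e => e.2 == d) (edges D).

(** Horizontal and vertical edges alternate, and after [n] steps the walk is back at its first edge;
    hence [n] is even and half of the edges are vertical. As many of these go up as down, which
    makes a quarter of the edges for each. *)
Lemma irreducible_edges p D e0 : border p D -> irreducible D -> e0 \in edges D ->
  exists b w, [/\ size (edges D) = (size w).+3,
    let C := trace (edge_tail e0) (edge_head e0) (edge_head e0 + (if b then rotl e0.2 else - rotl
      e0.2) *+ 2) w in
    uniq C /\ perm_eq [seq (edge_tail e, edge_head e) | e <- edges D] (closed_edges C)
    & forall d, d \in [:: (0, 1); (0, -1)] ->
      (4 * count_dir D d)%N = size (edges D)].
Proof.
move=> bD iD e0D; have [n [pE uc cn]] := irreducible_cycle bD iD e0D.
have d0 : e0.2 \in dirs by move: e0D; rewrite mem_edges => /and3P[].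
have szE : size (edges D) = n by rewrite (perm_size pE) size_map size_iota.
(* A trace has three corners besides one for each letter of its word, so at least three edges are
   required. *)
have n_gt2 : (2 < n)%N.
  have n0 : (0 < n)%N by rewrite -szE; case: (edges D) e0D.
  have c1 : walk_corner D e0 1%N != walk_corner D e0 0%N.
    rewrite walk_cornerS -subr_eq0 addrC addKr; move: d0; rewrite [walk_edge D e0 0%N]/=.
    by move: e0.2; apply: dirsP.
  have c2 : walk_corner D e0 2%N != walk_corner D e0 0%N.
    have : walk_corner D e0 2%N - walk_corner D e0 0%N =
      ((walk_edge D e0 0%N).2 + (walk_edge D e0 1%N).2) *+ 2.
      have aux (c a b : site) : c + a *+ 2 + b *+ 2 - c = (a + b) *+ 2.
        by case: c a b => [? ?] [? ?] [? ?]; congr pair => /=; lia.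
      by rewrite 2!walk_cornerS aux.
    rewrite -subr_eq0 => ->; rewrite [walk_edge D e0 0%N]/=.
    have := turn_dir D e0; rewrite -/(walk_edge D e0 1%N) => -[->|->];
      by move: d0; move: e0.2; apply: dirsP.
  case: n n0 cn {pE uc szE} => [|[|[|n]]] //.
    by move=> _ /eqP; rewrite (negPf c1).
  by move=> _ /eqP; rewrite (negPf c2).
have [w ws tw] := trace_walk D e0 0%N (n - 3).
have n3 : (n - 3)%N.+3 = n by lia.
have hd i : edge_head (walk_edge D e0 i) = walk_corner D e0 i.+1 by rewrite walk_head.
rewrite n3 in tw.
have c2E : walk_corner D e0 2%N = edge_head e0 + (walk_edge D e0 1%N).2 *+ 2 by rewrite
  walk_cornerS -(hd 0%N).
exists ((walk_edge D e0 1%N).2 == rotl e0.2), w; split; first by rewrite szE ws n3.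
  have -> : (if (walk_edge D e0 1%N).2 == rotl e0.2 then rotl e0.2 else - rotl e0.2) =
    (walk_edge D e0 1%N).2.
    by case: eqP => // ; have := turn_dir D e0; rewrite -/(walk_edge D e0 1%N) => -[->|->].
  rewrite -c2E -[edge_head e0]/(edge_head (walk_edge D e0 0%N)) hd -[edge_tail e0]/(walk_corner D
    e0 0%N) /= -tw; split=> //.
  rewrite /closed_edges rot_map_iota // (perm_trans (perm_map _ pE)) //.
  rewrite zip_map -map_comp (eq_map (g :=
    fun i => (walk_corner D e0 i, walk_corner D e0 i.+1))) // => i.
  by rewrite /= hd.
have cE : circuit (edges D).
  split; [exact: uniq_edges|by move=> e; rewrite mem_edges => /and3P[]|].
  rewrite (perm_trans (perm_map _ pE)) // perm_sym (perm_trans (perm_map _ pE)) // -!map_comp.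
  rewrite (eq_map (g := fun i => walk_corner D e0 i.+1)) => [|i]; last exact: hd.
  by rewrite -rot_map_iota // perm_rot.
have dE e : e \in edges D -> e.2 \in dirs by rewrite mem_edges => /and3P[].
have up_down : count_dir D (0, 1) = count_dir D (0, -1).
  have := circuit_sum (fun c => c.2) cE.
  rewrite (eq_big_seq (fun e : site * site => ((e.2 == (0, -1))%:Z - (e.2 == (0, 1))%:Z) * 2));
    last first.
    move=> [s d] /dE /=; rewrite /edge_tail /edge_head; case: s => s1 s2.
    by move: d; apply: dirsP; rewrite !xpair_eqE /=; lia.
  rewrite -mulr_suml sumrB !sum_count -/(count_dir D (0, 1)) -/(count_dir D (0, -1)).
  by move/eqP; rewrite mulf_eq0 orbF subr_eq0 => /eqP [->].
pose vert (e : site * site) := e.2.1 == 0.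
have vertE i : vert (walk_edge D e0 i) = odd i (+) vert e0.
  elim: i => // i IHi; rewrite [odd _]/= addNb -IHi.
  have := dE _ (walk_edge_in bD e0D i).
  have : (walk_edge D e0 i.+1).2 = rotl (walk_edge D e0 i).2 \/ (walk_edge D e0 i.+1).2 =
    - rotl (walk_edge D e0 i).2.
    exact: turn_dir.
  have aux d : d \in dirs ->
      ((rotl d).1 == 0) = ~~ (d.1 == 0) /\ ((- rotl d).1 == 0) = ~~ (d.1 == 0).
    by move: d; apply: dirsP.
  by rewrite /vert => -[->|->] /aux[].
have even_n : ~~ odd n.
  have : walk_edge D e0 n \in edges D by exact: walk_edge_in bD e0D n.
  rewrite (perm_mem pE) => /mapP[i]; rewrite mem_iota /= add0n => ltin oi.
  have i0 : i = 0%N.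
    have : nth 0 [seq walk_corner D e0 i | i <- iota 0 n] i == nth 0 [seq walk_corner D e0 i | i <-
      iota 0 n] 0.
      by rewrite !(nth_map 0%N) ?size_iota ?nth_iota // ?(leq_trans _ n_gt2) // -cn /walk_corner oi.
    by rewrite nth_uniq ?size_map ?size_iota // ?(leq_trans _ n_gt2) // => /eqP.
  by have := vertE n; rewrite oi i0 [vert _]/=; move: (odd n) (vert e0) => [] [].
have vert_count : (2 * count vert (edges D))%N = n.
  rewrite (permP pE) count_map (eq_count (a2 := fun i => odd i (+) vert e0)) //.
  by rewrite -(odd_double_half n) (negPf even_n) add0n count_parity -muln2 mulnC.
have ud_count : (count_dir D (0, 1)%R + count_dir D (0, -1)%R)%N = count vert (edges D).
  rewrite /count_dir -count_predUI [X in (_ + X)%N](eq_count (a2 := pred0)) ?count_pred0 ?addn0.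
    apply: eq_in_count => -[s d] /dE /=; rewrite /vert /=; move: d; exact: dirsP.
  by move=> [s d] /=; apply/andP => -[/eqP->].
move: vert_count; rewrite -ud_count szE => vc d; rewrite -[X in _ = X]vc !inE => /orP[] /eqP->.
  by rewrite -up_down addnn -mul2n mulnA.
by rewrite up_down addnn -mul2n mulnA.
Qed.

(** * Counting contours *)

Lemma site_eq (u v : site) : u.1 = v.1 -> u.2 = v.2 -> u = v.
Proof. by case: u v => [? ?] [? ?] /= -> ->. Qed.

(** Going up from a site of [D] in column [x], the first exit gives a boundary edge directed to the
    left in this column. *)
Lemma leq_edges (D : {fset site}) (xs : seq int) :
  uniq xs -> {in xs, forall x, exists y, (x, y) \in D} -> (size xs <= size (edges D))%N.
Proof.
move=> uxs xsD; rewrite -(size_map (fun e : site * site => e.1.1)).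
apply: uniq_leq_size => // x /xsD[y xyD]; have [N DN] := fset_in_box D.
have : exists k : nat, (x, y + k%:Z) \notin D.
  by exists (N + `|y|).+1; apply/negP => /DN; rewrite /in_box /=; lia.
case/ex_minnP => -[|k] kD kmin; first by rewrite addr0 xyD in kD.
apply/mapP; exists ((x, y + k%:Z), (-1, 0)) => //; rewrite mem_edges.
rewrite [_.1 - _](_ : _ = (x, y + k.+1%:Z)); last first.
  by apply: site_eq => /=; lia.
by rewrite kD /= !andbT; apply/negPn/negP => /kmin; rewrite ltnn.
Qed.

(** Take the first exit to the right of [a]. The sites passed on the way lie in distinct columns, so
    their number is at most that of the edges. *)
Lemma exit_edge D a : a \in D ->
  exists2 k, (k < size (edges D))%N & (a + (k%:Z, 0), (0, 1)) \in edges D.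
Proof.
case: a => a1 a2 aD; have [N DN] := fset_in_box D.
have : exists k : nat, (a1 + k%:Z, a2) \notin D.
  by exists (N + `|a1|).+1; apply/negP => /DN; rewrite /in_box /=; lia.
case/ex_minnP => -[|k] kD kmin; first by rewrite addr0 aD in kD.
have leD j : (j <= k)%N -> (a1 + j%:Z, a2) \in D.
  by move=> jk; apply/negPn/negP => /kmin; rewrite leqNgt ltnS jk.
exists k.
  rewrite -[k.+1](size_iota 0) -(size_map (fun j : nat => a1 + j%:Z)).
  apply: leq_edges => [|x].
    by rewrite map_inj_uniq ?iota_uniq // => i j /addrI [].
  by case/mapP => j; rewrite mem_iota add0n => jk ->; exists a2; apply: leD.
have -> : (a1, a2) + (k%:Z, 0) = (a1 + k%:Z, a2) by apply: site_eq => /=; lia.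
rewrite mem_edges leD //=.
by have -> : (a1 + k%:Z, a2) - rotl (0, 1) = (a1 + k.+1%:Z, a2) by apply: site_eq => /=; lia.
Qed.

Record contour (p : bool) (a : site) (m : nat) (D : {fset site}) : Prop := Contour {
  contour_diag : forall i, (i < m.+1)%N -> diag a i \in D;
  contour_border : border p D;
  contour_irreducible : irreducible D }.

(** The diagonal segment meets [m + 1] columns. *)
Lemma contour_size p a m D : contour p a m D -> (m < size (edges D))%N.
Proof.
move=> [diagD _ _]; rewrite -[m.+1](size_iota 0) -(size_map (fun j : nat => a.1 + j%:Z)).
apply: leq_edges => [|x].
  by rewrite map_inj_uniq ?iota_uniq // => i j /addrI [].
case/mapP => j; rewrite mem_iota add0n => jm ->; exists (a.2 + j%:Z).
exact: diagD jm.
Qed.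

(* A contour is encoded by the abscissa of its first exit on the ray from [a], by its first turn,
   and by the word of its other turns. *)
Definition decode (a : site) (c : nat * bool * seq bool) : seq site :=
  let e := (a + (c.1.1%:Z, 0), (0, 1)) in
  trace (edge_tail e) (edge_head e) (edge_head e + (if c.1.2 then rotl e.2 else - rotl e.2) *+ 2)
    c.2.

Definition encodes (a : site) (D : {fset site}) (c : nat * bool * seq bool) : Prop :=
  [/\ (c.1.1 < size (edges D))%N, size (edges D) = (size c.2).+3, saw c.2
    & perm_eq [seq (edge_tail e, edge_head e) | e <- edges D] (closed_edges (decode a c))].

Lemma contour_code p a m D : contour p a m D -> exists c, encodes a D c.
Proof.
move=> [diagD bD iD]; have aD : a \in D by have := diagD 0%N isT; rewrite /diag addr0.
have [k kD eD] := exit_edge aD.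
have [b [w [Dw [uw pw] _]]] := irreducible_edges bD iD eD.
exists (k, b, w); split=> //; move: uw; rewrite uniq_trace //.
have -> : edge_head (a + (k%:Z, 0), (0, 1)) - edge_tail (a + (k%:Z, 0), (0, 1)) = (0, 2).
  by rewrite /edge_head /edge_tail /=; case: (a + _) => x y; apply: site_eq => /=; lia.
by rewrite [_ + _ *+ 2]addrC addrK; case: b {pw}.
Qed.

Lemma code_inj a c D1 D2 :
  perm_eq [seq (edge_tail e, edge_head e) | e <- edges D1] (closed_edges (decode a c)) ->
  perm_eq [seq (edge_tail e, edge_head e) | e <- edges D2] (closed_edges (decode a c)) -> D1 = D2.
Proof.
suff sub E E' : perm_eq [seq (edge_tail e,
  edge_head e) | e <- edges E] (closed_edges (decode a c)) ->
    perm_eq [seq (edge_tail e, edge_head e) | e <- edges E'] (closed_edges (decode a c)) ->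
    {subset edges E <= edges E'}.
  by move=> h1 h2; apply: edges_inj => e; apply/idP/idP; apply: sub.
move=> h h' e eE; have dirE F f : f \in edges F -> f.2 \in dirs by rewrite mem_edges => /and3P[].
have : (edge_tail e, edge_head e) \in [seq (edge_tail e, edge_head e) | e <- edges E].
  by apply/mapP; exists e.
rewrite (perm_mem h) -(perm_mem h') => /mapP[f fE' th].
by rewrite (tail_head_inj (dirE _ _ eE) (dirE _ _ fE') (congr1 fst th) (congr1 snd th)).
Qed.

Lemma count_contours p a m q (Ds : seq {fset site}) :
  uniq Ds -> {in Ds, forall D, contour p a m D /\ size (edges D) = (4 * q)%N} ->
  (size Ds <= 4 * q * 2 * count saw (words (4 * q - 3)))%N.
Proof.
move=> uDs DsP; pose n := (4 * q - 3)%N.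
pose code D := if pselect (exists c, encodes a D c) is left h then sval (cid h)
  else (0%N, true, [::]).
have codeP D : D \in Ds -> encodes a D (code D).
  move=> /DsP[/contour_code cD _]; rewrite /code; case: pselect => // h.
  by case: (cid h).
pose bs := [:: true; false].
pose codes := [seq (kb, w) | kb <- [seq (k, b) | k <- iota 0 (4 * q), b <- bs],
   w <- [seq w <- words n | saw w]].
have -> : (4 * q * 2 * count saw (words n))%N = size codes.
  by rewrite /codes !size_allpairs size_iota size_filter.
rewrite -(size_map code); apply: uniq_leq_size.
  rewrite map_inj_in_uniq // => D1 D2 D1s D2s c12.
  have [_ _ _ h1] := codeP _ D1s; have [_ _ _ h2] := codeP _ D2s.
  by rewrite -c12 in h2; exact: code_inj h1 h2.
move=> _ /mapP[D Ds_D ->]; have [k_lt szw sw _] := codeP _ Ds_D.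
have [_ szD] := DsP _ Ds_D.
case: (code D) k_lt szw sw => -[k b] w /= k_lt szw sw.
have kb_in : (k, b) \in [seq (k, b) | k <- iota 0 (4 * q), b <- bs].
  by apply/allpairsP; exists (k, b); split; rewrite ?mem_iota -?szD //; case: (b).
apply/allpairsP; exists ((k, b), w); split=> //.
by rewrite mem_filter /= sw mem_words /n -szD szw -addn3 addnK eqxx.
Qed.

(** * Summation of the contour weights *)

Lemma geometric_sum_le (R : realFieldType) (t : R) n :
  0 <= t < 1 -> \sum_(i < n) t ^+ i <= (1 - t)^-1.
Proof.
move=> /andP[t0 t1]; rewrite -[leRHS]mul1r ler_pdivlMr ?subr_gt0 //.
have -> : (\sum_(i < n) t ^+ i) * (1 - t) = 1 - t ^+ n.
  by rewrite -[RHS]opprB subrX1 mulrC -mulNr opprB.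
by rewrite gerBl exprn_ge0.
Qed.

(** Each of the powers [t ^+ i] with [i < n] is at least [t ^+ n]. *)
Lemma mul_expr_le (R : realFieldType) (t : R) n : 0 <= t < 1 -> n%:R * t ^+ n <= (1 - t)^-1.
Proof.
move=> t01; have /andP[t0 t1] := t01; apply: le_trans (geometric_sum_le n t01).
rewrite -[n in n%:R]card_ord -sumr_const mulr_suml; apply: ler_sum => i _.
by rewrite mul1r; apply: ler_wiXn2l; rewrite ?(ltW t1) // ltnW.
Qed.

Lemma tail_sum_le (R : realType) (K r : R) : 0 <= K -> 0 <= r < 1 ->
  exists M, forall Q, \sum_(j < Q | (M < j)%N) K * (j%:R * r ^+ j) <= 2^-1.
Proof.
move=> K0 /andP[r0 r1].
have half (x : R) : 0 <= x < 1 -> [/\ 0 <= (1 + x) / 2, (1 + x) / 2 < 1 & x <= ((1 + x) / 2) ^+ 2].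
  by move=> /andP[x0 x1]; split; [lra|lra|nra].
(* By the arithmetic-geometric inequality [r <= t^2] and [t <= u^2]. One factor [t^j] absorbs [j];
   the other is at most [u^M u^j], which is small and summable. *)
pose t := (1 + r) / 2; pose u := (1 + t) / 2.
have [t0 t1 rt] : [/\ 0 <= t, t < 1 & r <= t ^+ 2] by apply: half; rewrite r0.
have [u0 u1 tu] : [/\ 0 <= u, u < 1 & t <= u ^+ 2] by apply: half; rewrite t0.
pose L := K * (1 - t)^-1 * (1 - u)^-1.
have [M uM] : exists M, L * u ^+ M <= 2^-1.
  have : (fun n => L * u ^+ n) @ \oo --> L * 0.
    by apply: cvgMr; apply: cvg_expr; rewrite ger0_norm.
  rewrite mulr0 => /cvgr0Pnorm_le /(_ 2^-1) -[|N _ hN]; first by rewrite invr_gt0.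
  by exists N; apply: le_trans (hN N (leqnn N)); rewrite ler_norm.
exists M => Q; apply: le_trans uM; rewrite /L -mulrA [_^-1 * u ^+ _]mulrC mulrA.
have term j : (M < j)%N -> K * (j%:R * r ^+ j) <= K * (1 - t)^-1 * u ^+ M * u ^+ j.
  move=> Mj; rewrite -!mulrA; apply: ler_wpM2l => //.
  have le1 : r ^+ j <= t ^+ j * t ^+ j by rewrite -exprMn -expr2 lerXn2r ?nnegrE ?exprn_ge0.
  have le2 : t ^+ j <= u ^+ M * u ^+ j.
    apply: le_trans (_ : u ^+ j * u ^+ j <= _).
      by rewrite -exprMn -expr2 lerXn2r ?nnegrE ?exprn_ge0.
    by rewrite ler_wpM2r ?exprn_ge0 //; apply: ler_wiXn2l; rewrite ?(ltW u1) // ltnW.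
  apply: le_trans (ler_wpM2l (ler0n _ j) le1) _; rewrite [leLHS]mulrA.
  apply: ler_pM => //; rewrite ?mulr_ge0 ?exprn_ge0 //.
  by apply: mul_expr_le; rewrite t0.
apply: (@le_trans _ _ (\sum_(j < Q | (M < j)%N) K * (1 - t)^-1 * u ^+ M * u ^+ j)).
  by apply: ler_sum => j /term.
rewrite -mulr_sumr; apply: ler_wpM2l.
  by rewrite !mulr_ge0 ?exprn_ge0 // invr_ge0 subr_ge0 ltW.
apply: le_trans (geometric_sum_le Q _); last by rewrite u0.
by rewrite [leRHS](bigID (fun j : 'I_Q => (M < j)%N)) /= lerDl sumr_ge0 // => i _;
  rewrite exprn_ge0.
Qed.

Lemma contour_sum (R : realType) (lambda : R) : 5 + 3646 / 10 ^+ 4 < lambda ->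
  exists m, forall p a d (Ds : seq {fset site}), d \in [:: (0, 1); (0, -1)] ->
    uniq Ds -> {in Ds, forall D, contour p a m D} ->
    \sum_(D <- Ds) (1 + lambda) ^- count_dir D d <= 2^-1.
Proof.
move=> hl; have [C sawC] := saw_count.
(* At most [8 j C theta^(4 j)] contours have [4 j] edges, each of weight [(1 + lambda)^(-j)], and
   [theta^4 = 1.588^4] is less than 6.3646. *)
pose theta : R := 397 / 250; pose r := theta ^+ 4 / (1 + lambda).
have l0 : 0 < 1 + lambda by lra.
have r01 : 0 <= r < 1.
  by rewrite /r /theta ltr_pdivrMr // mul1r divr_ge0 ?exprn_ge0 ?(ltW l0) //=; lra.
have [M hM] := @tail_sum_le R (8 * C%:R) r (mulr_ge0 (ler0n _ 8) (ler0n _ C)) r01.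
(* A contour has more than [m] edges, so with [4 j] edges it has [j > M]. *)
exists (4 * M)%N => p a d Ds dd uDs DsP.
have szD D : D \in Ds -> size (edges D) = (4 * count_dir D d)%N.
  move=> /DsP[diagD bD iD]; have aD : a \in D by have := diagD 0%N isT; rewrite /diag addr0.
  have [k _ eD] := exit_edge aD.
  by have [b [w [_ _ ->]]] := irreducible_edges bD iD eD.
have saw_le n : (count saw (words n))%:R <= C%:R * theta ^+ n.
  rewrite /theta expr_div_n mulrA ler_pdivlMr ?exprn_gt0 // mulrC [C%:R * _]mulrC.
  by rewrite -!natrX -!natrM ler_nat.
pose Q := (\max_(D <- Ds) count_dir D d).+1.
have ltQ D : D \in Ds -> (count_dir D d < Q)%N.
  by move=> DDs; rewrite ltnS; apply: (@leq_bigmax_seq _ _ xpredT (fun D => count_dir D d)).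
apply: le_trans (hM Q).
rewrite (partition_big (fun D => inord (count_dir D d) : 'I_Q) xpredT) //= [leRHS]big_mkcond /=.
apply: ler_sum => j _.
pose Dj := [seq D <- Ds | count_dir D d == j].
have inordE D : D \in Ds -> (inord (count_dir D d) == j) = (count_dir D d == j).
  by move=> DDs; rewrite -val_eqE /= inordK // ltQ.
have -> : \sum_(D <- Ds | inord (count_dir D d) == j) (1 + lambda) ^- count_dir D d =
    (size Dj)%:R * (1 + lambda) ^- j.
  rewrite -[LHS]big_filter -[size Dj]sum1_size natr_sum mulr_suml.
  have -> : [seq D <- Ds | inord (count_dir D d) == j] = Dj by apply: eq_in_filter.
  by apply: eq_big_seq => D; rewrite mem_filter mul1r => /andP[/eqP->].
have szj D : D \in Dj -> contour p a (4 * M) D /\ size (edges D) = (4 * j)%N.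
  by rewrite mem_filter => /andP[/eqP dj DDs]; rewrite szD // dj; split=> //; exact: DsP.
case: ifPn => [_|Mj]; last first.
  have -> : Dj = [::].
    case: Dj szj => // D s /(_ D (mem_head _ _)) [/contour_size ltD szE].
    by move: ltD Mj; rewrite szE ltn_mul2l -leqNgt => /= h1 /(leq_trans h1); rewrite ltnn.
  by rewrite mul0r.
have := count_contours (filter_uniq _ uDs) szj.
rewrite -(ler_nat R) => /le_trans le; rewrite /r expr_div_n !mulrA ler_pM2r ?invr_gt0 ?exprn_gt0 //.
apply: le; rewrite natrM.
apply: le_trans (ler_wpM2l (ler0n _ _) (saw_le _)) _.
have -> : (4 * j * 2)%:R = 8 * j%:R :> R by rewrite !natrM; ring.
rewrite mulrACA -!mulrA; do 3!(apply: ler_wpM2l; rewrite ?ler0n //).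
rewrite -exprM; apply: ler_weXn2l; [rewrite /theta; lra | exact: leq_subr].
Qed.

(** * The Peierls inequality in finite volume *)

Lemma neighborsP (x y : site) : neighbors x y <-> exists2 d, d \in dirs & y = x + d.
Proof.
split=> [xy|[d dd ->]]; last first.
  by case: x => x1 x2; move: d dd; apply: dirsP; rewrite /neighbors /=; lia.
have xyE : y = x + (y - x) by rewrite addrC subrK.
exists (y - x) => //; move: xy {xyE}; case: x y => [x1 x2] [y1 y2].
rewrite /neighbors !inE !xpair_eqE /=; lia.
Qed.

Lemma neighbors_sym x y : neighbors x y -> neighbors y x.
Proof. by rewrite /neighbors; case: x y => [x1 x2] [y1 y2] /=; lia. Qed.

Lemma parity_neighbors x y : neighbors x y -> parity y = ~~ parity x.
Proof. by case/neighborsP => d dd ->; rewrite parity_dir. Qed.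

Lemma boundary_edge (D : {fset site}) x y : neighbors x y -> x \in D -> y \notin D ->
  exists2 e, e \in edges D & e.1 = x /\ e.1 - rotl e.2 = y.
Proof.
case/neighborsP => d dd -> xD yD; exists (x, rotl d); rewrite ?mem_edges /= ?rotlK ?opprK //.
by rewrite xD rotl_dirs.
Qed.

Section BigFset.
Variables (K : choiceType).

Lemma perm_fpowersetU (A B : {fset K}) : [disjoint A & B]%fset ->
  perm_eq (fpowerset (A `|` B)%fset)
    [seq (X `|` Y)%fset | X <- fpowerset A, Y <- fpowerset B].
Proof.
move=> AB; apply: uniq_perm; first exact: fset_uniq.
  apply: allpairs_uniq; try exact: fset_uniq.
  move=> _ _ /allpairsP[[X Y] [/= + + ->]] /allpairsP[[X' Y'] [/= + + ->]].
  rewrite !fpowersetE => XA YB XA' YB' /= XYe.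
  have inA Z W : (Z `<=` A)%fset -> (W `<=` B)%fset -> (Z = (Z `|` W) `&` A)%fset.
    move=> ZA WB; rewrite fsetIUl (fsetIidPl ZA) (_ : W `&` A = fset0)%fset ?fsetU0 //.
    by apply/eqP; rewrite fsetI_eq0 fdisjoint_sym (fdisjointWr WB).
  have inB Z W : (Z `<=` A)%fset -> (W `<=` B)%fset -> (W = (Z `|` W) `&` B)%fset.
    move=> ZA WB; rewrite fsetIUl (fsetIidPl WB) (_ : Z `&` B = fset0)%fset ?fset0U //.
    by apply/eqP; rewrite fsetI_eq0 (fdisjointWl ZA).
  have -> : X = X' by rewrite (inA _ _ XA YB) XYe -(inA _ _ XA' YB').
  by have -> : Y = Y' by rewrite (inB _ _ XA YB) XYe -(inB _ _ XA' YB').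
move=> X; rewrite fpowersetE; apply/idP/allpairsP => [XAB|[[Y Z] [/= + + ->]]].
  exists ((X `&` A)%fset, (X `&` B)%fset); rewrite !fpowersetE !fsubsetIr; split=> //=.
  by rewrite -fsetIUr; apply/esym/fsetIidPl.
by rewrite !fpowersetE; apply: fsetUSS.
Qed.

Lemma sum_fpowerset_expr (R : comPzRingType) (x : R) (A : {fset K}) :
  \sum_(X <- fpowerset A) x ^+ #|` X| = (1 + x) ^+ #|` A|.
Proof.
elim/finSet_rect: A => A IH; have [->|[a aA]] := fset_0Vmem A.
  by rewrite fpowerset0 big_seq_fset1 cardfs0 !expr0.
have IHa := IH (A `\ a)%fset (fproperD1 aA).
have dis : [disjoint [fset a] & A `\ a]%fset by rewrite fdisjoint1X !inE eqxx.
rewrite -[in LHS](fsetD1K aA) (perm_big _ (perm_fpowersetU dis)) big_allpairs_dep.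
rewrite fpowerset1 (big_fsetU1 _ _ (a := fset0)) ?big_seq_fset1; last first.
  by rewrite !inE eq_sym; apply/eqP => /fsetP/(_ a); rewrite !inE eqxx.
rewrite (cardfsD1 a A) aA exprD expr1 mulrDl mul1r -IHa; congr (_ + _).
  by apply: eq_bigr => X _; rewrite fset0U.
rewrite mulr_sumr; apply: eq_big_seq => X; rewrite fpowersetE => XA.
rewrite cardfsU1 exprD (_ : a \notin X) ?expr1 //.
by apply/negP => /(fsubsetP XA); rewrite !inE eqxx.
Qed.
End BigFset.

Lemma ler_sum_inj (R : numDomainType) (T U : eqType) (s : seq T) (t : seq U) (f : T -> U)
    (F : T -> R) (G : U -> R) :
  uniq s -> uniq t -> {in s &, injective f} -> {in s, forall x, f x \in t /\ F x <= G (f x)} ->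
  {in t, forall y, 0 <= G y} -> \sum_(x <- s) F x <= \sum_(y <- t) G y.
Proof.
move=> us ut fI st G0; apply: (@le_trans _ _ (\sum_(x <- s) G (f x))).
  by rewrite big_seq [leRHS]big_seq; apply: ler_sum => x /st[].
rewrite -(big_map f xpredT G) [leRHS](bigID (mem (map f s))) /=.
rewrite -[X in _ <= _ + X]big_filter -[X in _ <= X + _]big_filter.
have pE : perm_eq [seq y <- t | y \in map f s] (map f s).
  apply: uniq_perm; rewrite ?filter_uniq ?map_inj_in_uniq // => y.
  rewrite mem_filter andb_idr // => /mapP[x xs ->].
  by have [] := st _ xs.
rewrite (perm_big _ pE) lerDl big_seq sumr_ge0 // => y.
by rewrite mem_filter => /andP[_ /G0].
Qed.

(** * Shifting the particles inside a contour *)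

Definition filling (L : {fset site}) (I : set site) (J : {fset site}) : set site :=
  [set` J] `|` (I `\` [set` L]).

Definition ground_state (p : bool) : set site := [set x | parity x = p].

Definition freed (D : {fset site}) (s : site) : {fset site} :=
  [fset v in D | v - s \notin D]%fset.

Lemma mem_freed D s v : (v \in freed D s) = (v \in D) && (v - s \notin D).
Proof. by rewrite /freed !inE. Qed.

(** A site [v] is freed by the shift by [rotl d] exactly when [(v, d)] is a boundary edge. *)
Lemma card_freed D d : d \in dirs -> #|` freed D (rotl d)| = count_dir D d.
Proof.
move=> dd; rewrite /count_dir -size_filter -(size_map fst).
apply: perm_size; apply: uniq_perm; first exact: fset_uniq.
  rewrite map_inj_in_uniq; first exact/filter_uniq/uniq_edges.
  move=> [x1 d1] [x2 d2] /=.
  by rewrite !mem_filter /= => /andP[/eqP-> _] /andP[/eqP-> _] ->.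
move=> v; rewrite !inE /=; apply/andP/mapP => [[vD vsD]|[[x d'] + /= ->]].
  by exists (v, d); rewrite // mem_filter eqxx mem_edges /= vD dd.
by rewrite mem_filter mem_edges /= => /and4P[/eqP-> ? _ ?].
Qed.

(* The particles of [D] move by [s], and [T] is a set of new particles on the freed sites. *)
Definition shift (D : {fset site}) (s : site) (J T : {fset site}) : {fset site} :=
  (J `\` D `|` [fset (x + s)%R | x in (J `&` D)%fset] `|` T)%fset.

Section Shift.
Variables (p : bool) (L D : {fset site}) (d : site).
Hypotheses (dd : d \in dirs) (bD : border p D) (DL : (D `<=` L)%fset).
Let s := rotl d.

(** A particle leaving [D] would start from the inner side of the boundary edge [(x, - d)], which is
    vacant. *)
Lemma vacant_shift I x : vacant I D -> I x -> x \in D -> x + s \in D.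
Proof.
move=> vD Ix xD; apply/negPn/negP => xsD.
have eD : (x, - d) \in edges D by rewrite mem_edges xD opp_dirs // rotlN opprK xsD.
by have [] := vD _ eD.
Qed.

Lemma mem_shift I J T x : vacant (filling L I J) D -> (T `<=` freed D s)%fset ->
  (x \in shift D s J T) =
  [|| (x \in J) && (x \notin D), [&& x \in D, x - s \in D & x - s \in J] | x \in T].
Proof.
move=> vD TF; rewrite /shift 2!in_fsetU in_fsetD andbC -orbA; congr [|| _, _ | _].
apply/imfsetP/and3P => [[y /=]|[xD xsD xsJ]]; last first.
  by exists (x - s); rewrite /= ?subrK // in_fsetI xsJ.
rewrite in_fsetI => /andP[yJ yD] ->; rewrite addrK; split=> //.
by apply: (vacant_shift vD) => //; left.
Qed.

(** Particles outside [D] have no neighbour in [D], the outer side of the boundary being vacant. The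
    shifted particles keep their relative positions. One of them next to a freed site [v] was,
    before the shift, a particle of [D] next to [v - s] outside [D], against vacancy. Finally, the
    freed sites all have parity [p], so no two of them are neighbours. *)
Lemma independent_shift I J T : independent (filling L I J) -> vacant (filling L I J) D ->
  (T `<=` freed D s)%fset -> independent (filling L I (shift D s J T)).
Proof.
move=> indJ vD TF.
have freedE v : v \in T -> v \in D /\ v - s \notin D.
  by move/(fsubsetP TF); rewrite mem_freed => /andP[].
have cases x : filling L I (shift D s J T) x -> [\/ filling L I J x /\ x \notin D,
    [/\ x \in D, x - s \in D & filling L I J (x - s)] | x \in T].
  case=> [/=|[Ix xL]]; last first.
    apply: Or31; split; first by right.
    by apply/negP => /(fsubsetP DL).
  rewrite (mem_shift _ vD TF) => /or3P[/andP[xJ xD]|/and3P[xD xsD xsJ]|xT].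
  - by apply: Or31; split=> //; left.
  - by apply: Or32; split=> //; left.
  - exact: Or33.
have outside x y : neighbors x y -> filling L I J x -> x \notin D -> y \notin D.
  move=> /neighbors_sym xy Ix xD; apply/negP => yD.
  have [e eD [_ ex]] := boundary_edge xy yD xD.
  by have [_] := vD _ eD; rewrite ex.
have inside x v : neighbors x v -> x - s \in D -> filling L I J (x - s) -> v \notin T.
  move=> xv xsD Ixs; apply/negP => /freedE[_ vsD].
  have xvs : neighbors (x - s) (v - s).
    by case/neighborsP: xv => c cd ->; apply/neighborsP; exists c; rewrite // addrAC.
  have [e eD [ex _]] := boundary_edge xvs xsD vsD.
  by have [] := vD _ eD; rewrite ex.
move=> x y /cases hx /cases hy xy; have yx := neighbors_sym xy.
case: hx => [[Ix xD]|[xD xsD Ixs]|xT].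
- have yD := outside _ _ xy Ix xD; case: hy => [[Iy _]|[yD']|/freedE[yD']].
  + exact: indJ xy.
  + by rewrite yD' in yD.
  + by rewrite yD' in yD.
- case: hy => [[Iy yD]|[yD ysD Iys]|yT].
  + by have := outside _ _ yx Iy yD; rewrite xD.
  + apply: (indJ _ _ Ixs Iys); case/neighborsP: xy => c cd ->.
    by apply/neighborsP; exists c; rewrite // addrAC.
  + by have := inside _ _ xy xsD Ixs; rewrite yT.
- case: hy => [[Iy yD]|[yD ysD Iys]|yT].
  + by have := outside _ _ yx Iy yD; have [-> _] := freedE _ xT.
  + by have := inside _ _ yx ysD Iys; rewrite xT.
  + have par_freed v : v \in T -> parity v = p.
      move/freedE => [vD' vsD]; have : (v, d) \in edges D by rewrite mem_edges vD' dd.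
      by move/bD.
    by have := parity_neighbors xy; rewrite !par_freed //; case: (p).
Qed.

Lemma card_shift I J T : vacant (filling L I J) D -> (T `<=` freed D s)%fset ->
  #|` shift D s J T| = (#|` J| + #|` T|)%N.
Proof.
move=> vD TF; rewrite /shift.
have TE v : v \in T -> v \in D /\ v - s \notin D.
  by move/(fsubsetP TF); rewrite mem_freed => /andP[].
have ShD v : v \in [fset (x + s)%R | x in (J `&` D)%fset]%fset -> v \in D /\ v - s \in D.
  case/imfsetP => y /=; rewrite in_fsetI => /andP[yJ yD] ->; rewrite addrK; split=> //.
  by apply: (vacant_shift vD) => //; left.
rewrite cardfsU (_ : _ `&` T = fset0)%fset ?cardfs0 ?subn0; last first.
  apply/fsetP => v; rewrite in_fsetI in_fsetU in_fset0 in_fsetD;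
    apply/negP => /andP[+ /TE[vD' vsD]].
  by rewrite vD' /= => /ShD[_]; rewrite (negPf vsD).
rewrite cardfsU (_ : (J `\` D) `&` _ = fset0)%fset ?cardfs0 ?subn0; last first.
  apply/fsetP => v; rewrite in_fsetI in_fset0 in_fsetD; apply/negP => /andP[/andP[vD' _] /ShD[]].
  by rewrite (negPf vD').
rewrite [#|` [fset (x + s)%R | x in _]%fset|]card_imfset /=; last by move=> u v /(addIr s).
by rewrite -(cardfsID D J) -!addnA addnCA.
Qed.

(** [T] is read on the freed sites, [J] off [D] is unchanged, and a particle of [J] at [x] in [D] is
    found at [x + s]. *)
Lemma shift_inj I J T J' T' :
  vacant (filling L I J) D -> vacant (filling L I J') D ->
  (T `<=` freed D s)%fset -> (T' `<=` freed D s)%fset ->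
  shift D s J T = shift D s J' T' -> J = J' /\ T = T'.
Proof.
move=> vD vD' TF TF' /fsetP e.
have TE v U : (U `<=` freed D s)%fset -> v \in U -> v \in D /\ v - s \notin D.
  by move=> UF /(fsubsetP UF); rewrite mem_freed => /andP[].
have shE x := mem_shift x vD TF; have shE' x := mem_shift x vD' TF'.
split; apply/fsetP => x; last first.
  have [/andP[xD xsD]|] := boolP ((x \in D) && (x - s \notin D)).
    have := e x; rewrite (mem_shift x vD TF) (mem_shift x vD' TF').
    by rewrite xD (negPf xsD) !andbF.
  by move=> nx; apply/idP/idP => /TE => /(_ ltac:(assumption)) [xD xsD]; rewrite xD xsD in nx.
have [xD|xD] := boolP (x \in D); last first.
  have := e x; rewrite (mem_shift x vD TF) (mem_shift x vD' TF') (negPf xD) !andbT.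
  have nT U : (U `<=` freed D s)%fset -> (x \in U) = false.
    by move=> UF; apply/negP => /(TE _ _ UF) []; rewrite (negPf xD).
  by rewrite (nT T) // (nT T') // !orbF.
have [xsD|xsD] := boolP (x + s \in D); last first.
  have nJ K : vacant (filling L I K) D -> (x \in K) = false.
    move=> vK; apply/negP => xK; move: xsD; rewrite (vacant_shift vK) //; by left.
  by rewrite !nJ.
have := e (x + s); rewrite (mem_shift _ vD TF) (mem_shift _ vD' TF') xsD addrK xD !andbF /=.
have nT U : (U `<=` freed D s)%fset -> (x + s \in U) = false.
  by move=> UF; apply/negP => /(TE _ _ UF) []; rewrite addrK xD.
by rewrite (nT T) // (nT T') // !orbF.
Qed.
End Shift.

(** From a site of [D] outside the box, walk straight away from the box. The inner site where the
    walk leaves [D] has parity [p] and lies outside the box, so the ground state occupies it,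
    against vacancy. *)
Lemma vacant_in_box n p D J : border p D -> vacant (filling (box n) (ground_state p) J) D ->
  (D `<=` box n)%fset.
Proof.
move=> bD vD; apply/fsubsetP => x xD; apply/negPn/negP => xn; have [N DN] := fset_in_box D.
have kE (u v : int) (k : nat) : (u, v) *+ k = (u *+ k, v *+ k).
  by elim: k => // k IHk; rewrite !mulrSr IHk.
have [d dd esc] : exists2 d, d \in dirs & forall k : nat, x + d *+ k \notin box n.
  move: xn; rewrite mem_box /in_box negb_and -!ltnNge; case: x {xD} => x1 x2 /= xn.
  case/orP: xn => h.
    have [x0|x0] := leP 0 x1; [exists (1, 0)|exists (-1, 0)] => // k;
      by rewrite mem_box /in_box kE negb_and -!ltnNge /=; lia.
  have [x0|x0] := leP 0 x2; [exists (0, 1)|exists (0, -1)] => // k;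
    by rewrite mem_box /in_box kE negb_and -!ltnNge /=; lia.
have stay k : x + d *+ k \in D.
  elim: k => [|k IHk]; first by rewrite addr0.
  apply/negPn/negP => kD.
  have nb : neighbors (x + d *+ k) (x + d *+ k.+1).
    by apply/neighborsP; exists d; rewrite // mulrSr addrA.
  have [e eD [e1 _]] := boundary_edge nb IHk kD.
  have [] := vD _ eD; rewrite e1 => + _; apply.
  by right; split; [rewrite /ground_state /= -e1; exact: bD | apply/negP/esc].
have := DN _ (stay (N + `|x.1| + `|x.2|).+1); rewrite /in_box.
move: d dd {esc stay}; apply: dirsP; rewrite kE /=; lia.
Qed.

(** Start from the particles of the wrong parity together with their neighbours. An inner boundary
    site is then a neighbour of such a particle, so it has parity [p] and is vacant; an outer one
    has the wrong parity and, not being among these particles, is vacant too. *)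
Lemma contour_exists n p a m J : (J `<=` box n)%fset ->
  independent (filling (box n) (ground_state p) J) -> parity a = ~~ p ->
  (forall i, (i < m.+1)%N -> diag a i \in J) ->
  exists D, [/\ contour p a m D, vacant (filling (box n) (ground_state p) J) D & (D `<=` box
    n)%fset].
Proof.
move=> Jn indJ pa diagJ; pose I := filling (box n) (ground_state p) J.
have pdiag i : parity (diag a i) = ~~ p.
  by rewrite -pa /parity /diag; case: a {pa diagJ} => a1 a2 /=; lia.
pose A := [fset x in J | parity x == ~~ p]%fset.
pose nbA : seq (site * site) := [seq (x, d) | x <- A, d <- dirs].
pose D0 := (A `|` [fset (u.1 + u.2)%R | u in nbA])%fset.
have AI x : x \in A -> I x by rewrite !inE => /andP[xJ _]; left.
have memN y : y \in [fset (u.1 + u.2)%R | u in nbA]%fset <->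
    exists2 x, x \in A & neighbors x y.
  split.
    case/imfsetP => u /= /allpairsP[[x d] [/= xA dd ->]] ->; exists x => //.
    by apply/neighborsP; exists d.
  case=> x xA /neighborsP[d dd ->]; apply/imfsetP; exists (x, d) => //=.
  by apply/allpairsP; exists (x, d).
have D0P y : y \in D0 -> y \in A \/ exists2 x, x \in A & neighbors x y.
  by rewrite in_fsetU => /orP[|/memN]; [left|right].
have diagD i : (i < m.+1)%N -> diag a i \in D0.
  by move=> im; rewrite /D0 in_fsetU !inE diagJ //= pdiag eqxx.
have edgeP e : e \in edges D0 -> exists2 x,
  x \in A & neighbors x e.1 /\ neighbors e.1 (e.1 - rotl e.2).
  case: e => s d; rewrite mem_edges /= => /and3P[sD dd tD].
  have nb : neighbors s (s - rotl d).
    by apply/neighborsP; exists (- rotl d); rewrite // opp_dirs // rotl_dirs.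
  case: (D0P _ sD) => [sA|[x xA xs]]; last by exists x.
  by case/negP: tD; rewrite in_fsetU; apply/orP; right; apply/memN; exists s.
have parA x : x \in A -> parity x = ~~ p by rewrite !inE => /andP[_ /eqP].
have bD0 : border p D0.
  by move=> e /edgeP[x xA [/parity_neighbors -> _]]; rewrite parA // negbK.
have vD0 : vacant I D0.
  move=> e eD; have [x xA [xe et]] := edgeP _ eD; split=> [Ie|It].
    exact: indJ (AI _ xA) Ie xe.
  have pt : parity (e.1 - rotl e.2) = ~~ p by rewrite (parity_neighbors et) bD0.
  case: It => [tJ|[]]; last by rewrite /ground_state /= pt => /esym; case: (p).
  move: eD; rewrite mem_edges => /and3P[_ _ /negP]; apply.
  by rewrite in_fsetU !inE tJ pt eqxx.
have [D [dD bD vD iD]] := irreducible_exists (fun i im => or_introl (diagJ i im)) diagD bD0 vD0.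
by exists D; split=> //; apply: vacant_in_box bD vD.
Qed.

Definition diag_fset (a : site) (m : nat) : {fset site} :=
  [fset x in [seq diag a i | i <- iota 0 m.+1]]%fset.

Lemma diag_fsetP a m (J : {fset site}) :
  reflect (forall i, (i < m.+1)%N -> diag a i \in J) (diag_fset a m `<=` J)%fset.
Proof.
apply: (iffP idP) => [/fsubsetP h i im|h]; last apply/fsubsetP => x.
  by apply: h; rewrite in_fset; apply: map_f; rewrite mem_iota.
by rewrite in_fset => /mapP[i]; rewrite mem_iota => im ->; apply: h.
Qed.

Lemma weight_ge0 (R : realType) (lambda : R) L I J : 0 <= lambda -> 0 <= weight lambda L I J.
Proof. by move=> l0; rewrite /weight; case: asbool => //; apply: exprn_ge0. Qed.

(** Expand the power of [1 + lambda] over the subsets [T] of the freed sites. The map from [(J, T)]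
    to the shifted configuration is injective, accounts for the factor [lambda^|T|], and moves the
    segment along with the particles. *)
Lemma peierls_contour (R : realType) (lambda : R) n p a m d D :
  0 <= lambda -> d \in dirs -> contour p a m D -> (D `<=` box n)%fset ->
  \sum_(J <- fpowerset (box n) | (diag_fset a m `<=` J)%fset &&
    `[< vacant (filling (box n) (ground_state p) J) D >])
     weight lambda (box n) (ground_state p) J * (1 + lambda) ^+ count_dir D d <=
  \sum_(J <- fpowerset (box n) | (diag_fset (a + rotl d)%R m `<=` J)%fset) weight lambda (box n)
    (ground_state p) J.
Proof.
move=> l0 dd [diagD bD _] Dn; rewrite -card_freed //.
under eq_bigr => J _ do rewrite -sum_fpowerset_expr mulr_sumr.
rewrite big_mkcond [leRHS]big_mkcond /=.
pose good J := [&& (diag_fset a m `<=` J)%fset,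
  `[< vacant (filling (box n) (ground_state p) J) D >] &
  `[< independent (filling (box n) (ground_state p) J) >]].
pose pairs := [seq (J, T) | J <- [seq J <- fpowerset (box n) | good J],
  T <- fpowerset (freed D (rotl d))].
have -> : \sum_(J <- fpowerset (box n)) (if (diag_fset a m `<=` J)%fset &&
  `[< vacant (filling (box n) (ground_state p) J) D >]
    then \sum_(T <- fpowerset (freed D (rotl d))) weight lambda (box n) (ground_state p) J * lambda
      ^+ #|` T| else 0)
  = \sum_(u <- pairs) lambda ^+ (#|` u.1| + #|` u.2|).
  rewrite big_allpairs big_filter [RHS]big_mkcond /=; apply: eq_bigr => J _.
  rewrite /good andbA; case: (_ && _) => //=.
  rewrite /weight -/(filling _ _ _); case: asbool => /=.
    by apply: eq_bigr => T _; rewrite exprD.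
  by rewrite big1 // => T _; rewrite mul0r.
have pairsP u : u \in pairs -> [/\ (u.1 `<=` box n)%fset,
  good u.1 & (u.2 `<=` freed D (rotl d))%fset].
  case/allpairsP => -[J T] [/= + + ->] /=; rewrite mem_filter !fpowersetE => /andP[gJ Jn] TF.
  by split.
apply: (@ler_sum_inj _ _ _ _ _ (fun u => shift D (rotl d) u.1 u.2)).
- apply: allpairs_uniq; [exact/filter_uniq/fset_uniq|exact: fset_uniq|].
  by move=> [? ?] [? ?].
- exact: fset_uniq.
- move=> [J T] [J' T'] /pairsP[/= _ /and3P[_ /asboolP vD _] TF] /pairsP[/= _ /and3P[_ /asboolP vD'
  _] TF'].
  by move/(shift_inj dd vD vD' TF TF') => [-> ->].
- move=> [J T] /pairsP[/= Jn /and3P[/diag_fsetP SJ /asboolP vD /asboolP indJ] TF].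
  rewrite fpowersetE; split.
    apply/fsubsetP => x; rewrite (mem_shift dd _ vD TF) => /or3P[/andP[/(fsubsetP
      Jn)//]|/and3P[/(fsubsetP Dn)//]|].
    by move/(fsubsetP TF); rewrite mem_freed => /andP[/(fsubsetP Dn)].
  rewrite ifT; last first.
    apply/diag_fsetP => i im; rewrite (mem_shift dd _ vD TF).
    have -> : diag (a + rotl d) i = diag a i + rotl d by rewrite /diag addrAC.
    rewrite addrK diagD // SJ // (vacant_shift dd vD) ?diagD ?orbT //.
    by left; apply: SJ.
  rewrite /weight -/(filling _ _ _) (card_shift dd vD TF).
  by rewrite asboolT ?lexx //; exact: (independent_shift dd bD Dn indJ vD TF).
- by move=> J _; case: ifP => // _; apply: weight_ge0.
Qed.

(** A union bound over the contours: each configuration of positive weight that contains the segment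
    has one, and each contour costs a factor [(1 + lambda) ^- count_dir D d]. *)
Lemma peierls (R : realType) (lambda : R) m n p a d :
  0 <= lambda -> parity a = ~~ p -> d \in dirs ->
  (forall Ds : seq {fset site}, uniq Ds -> {in Ds, forall D, contour p a m D} ->
    \sum_(D <- Ds) (1 + lambda) ^- count_dir D d <= 2^-1) ->
  \sum_(J <- fpowerset (box n) | (diag_fset a m `<=` J)%fset) weight lambda (box n) (ground_state
    p) J <=
  2^-1 * \sum_(J <- fpowerset (box n) | (diag_fset (a + rotl d)%R m `<=` J)%fset)
     weight lambda (box n) (ground_state p) J.
Proof.
move=> l0 pa dd hsum; set RHS := (X in _ <= _ * X).
have RHS0 : 0 <= RHS by apply: sumr_ge0 => J _; apply: weight_ge0.
pose Ds := [seq D <- fpowerset (box n) | `[< contour p a m D >]].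
have DsP D : D \in Ds -> contour p a m D /\ (D `<=` box n)%fset.
  by rewrite mem_filter fpowersetE => /andP[/asboolP ? ?].
have := hsum Ds (filter_uniq _ (fset_uniq _)) (fun D h => (DsP D h).1).
move/(ler_wpM2r RHS0); apply: le_trans; rewrite mulr_suml.
have l1 : 0 < 1 + lambda by apply: ltr_pwDl.
apply: (@le_trans _ _ (\sum_(D <- Ds)
  \sum_(J <- fpowerset (box n) | (diag_fset a m `<=` J)%fset &&
    `[< vacant (filling (box n) (ground_state p) J) D >])
    weight lambda (box n) (ground_state p) J)); last first.
  rewrite big_seq [leRHS]big_seq; apply: ler_sum => D /DsP[cD Dn].
  rewrite mulrC ler_pdivlMr ?exprn_gt0 // mulr_suml.
  exact: peierls_contour.
under [leRHS]eq_bigr => D _ do rewrite big_mkcondr.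
rewrite exchange_big /= big_seq_cond [leRHS]big_seq_cond; apply: ler_sum => J /andP[].
rewrite fpowersetE => Jn /diag_fsetP SJ.
have [indJ|nindJ] := pselect (independent (filling (box n) (ground_state p) J)); last first.
  rewrite {1}/weight -/(filling _ _ _) asboolF //; apply: sumr_ge0 => D _.
  by case: ifP => // _; apply: weight_ge0.
have [D [cD vD Dn]] := contour_exists Jn indJ pa SJ.
have DDs : D \in Ds by rewrite mem_filter fpowersetE Dn asboolT.
rewrite (perm_big _ (perm_to_rem DDs)) big_cons asboolT // lerDl.
by apply: sumr_ge0 => E _; case: ifP => // _; apply: weight_ge0.
Qed.

(** * Specifications and finite-volume measures *)

Definition same_off (L : {fset site}) (I I' : set site) : Prop := I `\` [set` L] = I' `\` [set` L].
Definition determined_off (L : {fset site}) (A : set (set site)) : Prop :=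
  forall I I', same_off L I I' -> A I -> A I'.
Definition determined_on (S : {fset site}) (A : set (set site)) : Prop :=
  forall I I', I `&` [set` S] = I' `&` [set` S] -> A I -> A I'.
Definition pattern (L J : {fset site}) : set (set site) := [set I | I `&` [set` L] = [set` J]].

Definition nbhd (L : {fset site}) : {fset site} :=
  ([fset (u.1 + u.2)%R | u in [seq (x, d) | x <- L, d <- dirs]] `\` L)%fset.

Lemma mem_nbhd L y : (y \in nbhd L) <-> y \notin L /\ exists2 x, x \in L & neighbors x y.
Proof.
rewrite /nbhd in_fsetD; split=> [/andP[-> /imfsetP[[x d] /= h ->]]|[-> [x xL /neighborsP[d dd
  ->]]]].
  split=> //; have /allpairsP[[x' d'] [/= xL dd [-> ->]]] : (x, d) \in [seq (x, d) | x <- L,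
    d <- dirs] by [].
  by exists x' => //; apply/neighborsP; exists d'.
apply/imfsetP; exists (x, d) => //=.
have : (x, d) \in [seq (x, d) | x <- L, d <- dirs] by apply/allpairsP; exists (x, d).
by [].
Qed.

Lemma pattern_exists B I : exists2 K, (K `<=` B)%fset & pattern B K I.
Proof.
exists [fset x in B | `[< I x >]]%fset; first by apply/fsubsetP => x; rewrite !inE => /andP[].
apply/seteqP; split=> x /=; rewrite !inE; first by move=> [Ix ->]; rewrite asboolT.
by move=> /andP[-> /asboolP].
Qed.

Lemma sum_pattern (R : pzRingType) (F : {fset site} -> R) B I K :
  (K `<=` B)%fset -> pattern B K I ->
  \sum_(M <- fpowerset B) F M * \1_(pattern B M) I = F K.
Proof.
move=> KB IK; rewrite (big_fsetD1 K) /= ?fpowersetE // indicE mem_set // mulr1.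
rewrite big_seq big1 ?addr0 // => M; rewrite in_fsetD1 => /andP[MK _].
rewrite indicE memNset ?mulr0 // /pattern /= IK => /seteqP[h1 h2].
by case/eqP: MK; apply/fsetP => x; apply/idP/idP; [exact: h2|exact: h1].
Qed.

Section Specification.
Variables (R : realType) (lambda : R).
Hypothesis l0 : 0 < lambda.

Lemma weight_same_off L I I' J : same_off L I I' -> weight lambda L I J = weight lambda L I' J.
Proof. by rewrite /weight => ->. Qed.

Lemma specification_same_off L I I' J : same_off L I I' ->
  specification lambda L I J = specification lambda L I' J.
Proof.
move=> II'; rewrite /specification /partition_function (weight_same_off _ II').
by congr (_ / _); apply: eq_bigr => K _; apply: weight_same_off.
Qed.

Lemma partition_function_ge0 L I : 0 <= partition_function lambda L I.
Proof. by apply: sumr_ge0 => J _; apply: weight_ge0; apply: ltW. Qed.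

Lemma specification_ge0 L I J : 0 <= specification lambda L I J.
Proof. by rewrite divr_ge0 ?partition_function_ge0 ?weight_ge0 // ltW. Qed.

Lemma partition_function_gt0 L I : independent (I `\` [set` L]) ->
  0 < partition_function lambda L I.
Proof.
move=> iI; rewrite /partition_function (big_fsetD1 fset0) /=; last by rewrite fpowersetE fsub0set.
apply: ltr_pwDl; last by apply: sumr_ge0 => J _; apply: weight_ge0; apply: ltW.
rewrite /weight asboolT ?cardfs0 ?expr0 // (_ : [set` fset0] = set0) ?set0U //.
by apply/seteqP; split=> x //=; rewrite in_fset0.
Qed.

Lemma independent_filling_nbhd L I J : (J `<=` L)%fset -> independent (I `\` [set` L]) ->
  independent (filling L (I `&` [set` nbhd L]) J) -> independent (filling L I J).
Proof.
move=> JL iI iJ.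
have key x y : x \in J -> (I `\` [set` L]) y -> ~ neighbors x y.
  move=> xJ [Iy /negP yL] xy; apply: (iJ x y _ _ xy); first by left.
  right; split; last exact/negP; split=> //=.
  by apply/mem_nbhd; split=> //; exists x => //; exact: (fsubsetP JL).
move=> x y [/= xJ|Ix] [/= yJ|Iy] xy.
- by apply: (iJ x y) xy; left.
- exact: (key x y) xy.
- exact: (key y x) (neighbors_sym xy).
- exact: (iI x y) xy.
Qed.

Lemma weight_nbhd L I J : (J `<=` L)%fset -> independent (I `\` [set` L]) ->
  weight lambda L I J = weight lambda L (I `&` [set` nbhd L]) J.
Proof.
move=> JL iI; rewrite /weight -!/(filling _ _ _); case: asboolP => h1; case: asboolP => h2 //.
  case: h2 => x y hx hy; apply: h1.
    by case: hx => [|[[? _] ?]]; [left|right].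
  by case: hy => [|[[? _] ?]]; [left|right].
by case: h1; apply: independent_filling_nbhd.
Qed.

(** The interaction has range one: once [I] is independent outside [L], only the neighbours of [L]
    can exclude particles of [L]. *)
Lemma specification_nbhd L I J : (J `<=` L)%fset -> independent (I `\` [set` L]) ->
  specification lambda L I J = specification lambda L (I `&` [set` nbhd L]) J.
Proof.
move=> JL iI; rewrite /specification weight_nbhd //; congr (_ / _).
rewrite /partition_function; apply: eq_big_seq => K; rewrite fpowersetE => KL.
exact: weight_nbhd.
Qed.

Lemma specification_dependent L I J : ~ independent (I `\` [set` L]) ->
  specification lambda L I J = 0.
Proof.
move=> nI; rewrite /specification /weight asboolF ?mul0r // => h; apply: nI => x y Ix Iy.
by apply: h; right.
Qed.

(** A finite combination of indicators, whose integral is therefore a finite sum. The specification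
    is zero when [I] is not independent outside [L]. *)
Lemma specification_sum L I J : (J `<=` L)%fset ->
  specification lambda L I J =
  \sum_(K <- fpowerset (nbhd L)) specification lambda L [set` K] J *
    \1_(pattern (nbhd L) K `&` [set I | independent (I `\` [set` L])]) I.
Proof.
move=> JL; have [iI|nI] := pselect (independent (I `\` [set` L])); last first.
  rewrite specification_dependent // big1 // => K _.
  by rewrite indicE memNset ?mulr0 // => -[].
have [K KB IK] := pattern_exists (nbhd L) I.
have ind1 : \1_[set I | independent (I `\` [set` L])] I = 1 :> R by rewrite indicE mem_set.
under eq_bigr => M _ do rewrite indicI [(_ \* _) _]/= ind1 mulr1.
by rewrite (sum_pattern (fun M => specification lambda L [set` M] J) KB IK) -IK specification_nbhd.
Qed.
End Specification.

Lemma sum_fsetD1 (K : choiceType) (V : nmodType) (a : K) (A : {fset K}) (F : K -> V) :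
  a \in A -> \sum_(i <- A) F i = F a + \sum_(i <- (A `\ a)%fset) F i.
Proof. exact: big_fsetD1. Qed.

Section FiniteVolume.
Variables (R : realType) (lambda : R) (p : bool).
Hypothesis l0 : 0 < lambda.

Definition finite_gibbs (n : nat) (A : set (set site)) : R :=
  (\sum_(J <- fpowerset (box n))
     weight lambda (box n) (ground_state p) J * \1_A (filling (box n) (ground_state p) J))
  / partition_function lambda (box n) (ground_state p).

Lemma independent_ground_state X : independent (ground_state p `\` X).
Proof. by move=> x y [/= px _] [/= py _] /parity_neighbors; rewrite px py; case: (p). Qed.

Let Z0 n : 0 < partition_function lambda (box n) (ground_state p).
Proof. by apply: partition_function_gt0 => //; apply: independent_ground_state. Qed.

Lemma finite_gibbs_ge0 n A : 0 <= finite_gibbs n A.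
Proof.
rewrite divr_ge0 ?(ltW (Z0 n)) //; apply: sumr_ge0 => J _.
by rewrite mulr_ge0 ?weight_ge0 // ltW.
Qed.

Lemma finite_gibbsT n : finite_gibbs n setT = 1.
Proof.
rewrite /finite_gibbs; under eq_bigr => J _ do rewrite indicT mulr1.
by rewrite -/(partition_function _ _ _) divff // gt_eqF.
Qed.

Lemma finite_gibbsU n (A B : set (set site)) : A `&` B = set0 ->
  finite_gibbs n (A `|` B) = finite_gibbs n A + finite_gibbs n B.
Proof.
move=> AB; rewrite /finite_gibbs -mulrDl -big_split /=; congr (_ / _); apply: eq_bigr => J _.
rewrite -mulrDr; congr (_ * _); rewrite !indicE in_setU.
case: (boolP (_ \in A)) => [/set_mem xA|_]; last by rewrite add0r.
case: (boolP (_ \in B)) => [/set_mem xB|_]; last by rewrite addr0.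
by have : (A `&` B) (filling (box n) (ground_state p) J) by []; rewrite AB.
Qed.

Lemma finite_gibbs_dependent n (A : set (set site)) : (forall I, A I -> ~ independent I) ->
  finite_gibbs n A = 0.
Proof.
move=> Adep; rewrite /finite_gibbs big1 ?mul0r // => J _; rewrite indicE.
have [/set_mem /Adep h|] := boolP (_ \in A); last by rewrite mulr0.
by rewrite /weight -/(filling _ _ _) asboolF // mul0r.
Qed.

(** Split a configuration of the box into [K1] off [L] and [K2] in [L]. Its weight is [lambda^|K1|]
    times a weight in [L] with boundary condition [fill K1]. The event [A] and the specification
    depend on [K1] alone, so the sum over [K2] yields the partition function of [L]. *)
Lemma finite_gibbs_dlr n L J (A : set (set site)) : (L `<=` box n)%fset -> (J `<=` L)%fset ->
  determined_off L A ->
  finite_gibbs n (A `&` pattern L J) =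
  (\sum_(K <- fpowerset (box n)) weight lambda (box n) (ground_state p) K *
     (\1_A (filling (box n) (ground_state p) K) * specification lambda L (filling (box n)
       (ground_state p) K) J))
  / partition_function lambda (box n) (ground_state p).
Proof.
move=> Ln JL oA; rewrite /finite_gibbs; congr (_ / _).
have dis : [disjoint (box n `\` L) & L]%fset.
  by apply/fdisjointP => x; rewrite in_fsetD => /andP[].
have <- : (box n `\` L `|` L)%fset = box n.
  apply/fsetP => x; rewrite in_fsetU in_fsetD.
  by case: (boolP (x \in L)) => [/(fsubsetP Ln) -> //|_]; rewrite orbF.
rewrite 2!(perm_big _ (perm_fpowersetU dis)) !big_allpairs_dep.
apply: eq_big_seq => K1; rewrite fpowersetE => K1L.
pose fill (K : {fset site}) : set site := filling (box n `\` L `|` L)%fset (ground_state p) K.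
have fillE K2 : (K2 `<=` L)%fset -> same_off L (fill (K1 `|` K2)%fset) (fill K1).
  move=> K2L; apply/seteqP; split=> x [hx xL]; split=> //.
    case: hx => [|hb]; last by right.
    by rewrite /= in_fsetU => /orP[xK1|/(fsubsetP K2L)//]; left.
  case: hx => [/= xK1|hb]; last by right.
  by left; rewrite /= in_fsetU xK1.
have wE K2 : (K2 `<=` L)%fset -> weight lambda (box n `\` L `|` L)%fset (ground_state p) (K1 `|`
  K2)%fset =
    lambda ^+ #|` K1| * weight lambda L (fill K1) K2.
  move=> K2L; have card12 : #|` (K1 `|` K2)%fset| = (#|` K1| + #|` K2|)%N.
    rewrite cardfsU (_ : K1 `&` K2 = fset0)%fset ?cardfs0 ?subn0 //.
    by apply/eqP; rewrite fsetI_eq0 (fdisjointWl K1L) // (fdisjointWr K2L).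
  have setE : filling (box n `\` L `|` L)%fset (ground_state p) (K1 `|` K2)%fset =
    filling L (fill K1) K2.
    apply/seteqP; split=> x.
      case=> [/=|[bx xn]]; last by right; split; [right|move=> xL; apply: xn => /=;
        rewrite in_fsetU xL orbT].
      rewrite in_fsetU => /orP[xK1|]; last by left.
      right; split; first by left.
      by apply/negP; have := fsubsetP K1L _ xK1; rewrite in_fsetD => /andP[].
    case=> [/= xK2|[[/= xK1|] xL]]; [left|left|by right];
      by rewrite /= in_fsetU ?xK1 ?xK2 ?orbT.
  rewrite /weight -!/(filling _ _ _) setE card12 exprD.
  by case: asbool; rewrite ?mulr0.
have AE K2 : (K2 `<=` L)%fset -> \1_A (fill (K1 `|` K2)%fset) = \1_A (fill K1) :> R.
  move=> K2L; rewrite !indicE; congr (_ %:R); congr nat_of_bool.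
  apply/idP/idP => /set_mem h; apply/mem_set.
    exact: oA (fillE _ K2L) h.
  by apply: oA h; apply/esym/fillE.
have patE K2 : (K2 `<=` L)%fset -> fill (K1 `|` K2)%fset `&` [set` L] = [set` K2].
  move=> K2L; apply/seteqP; split=> x.
    case=> -[/=|[_ /= xn] xL]; last by case: xn; rewrite in_fsetU xL orbT.
    rewrite in_fsetU => /orP[/(fsubsetP K1L)|//].
    by rewrite in_fsetD => /andP[/negPf ->].
  by move=> /= xK2; split; [left; rewrite /= in_fsetU xK2 orbT|apply: (fsubsetP K2L)].
transitivity (lambda ^+ #|` K1| * (\1_A (fill K1) * weight lambda L (fill K1) J)).
  rewrite (@sum_fsetD1 _ _ J); last by rewrite fpowersetE.
  rewrite wE // -/(fill _) indicI [(_ \* _) _]/= AE // [\1_(pattern _ _) _]indicE mem_set ?mulr1;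
    last exact: patE.
  rewrite big_seq big1 ?addr0 => [|K2]; first by rewrite -mulrA [_ * \1_A _]mulrC.
  rewrite in_fsetD1 fpowersetE => /andP[K2J K2L].
  rewrite -/(fill _) [(_ \* _) _]/= [\1_(pattern _ _) _]indicE memNset ?mulr0 // /pattern /= patE
    // => /seteqP[h1 h2].
  by case/eqP: K2J; apply/fsetP => x; apply/idP/idP; [exact: h1|exact: h2].
rewrite (eq_big_seq (fun K2 => lambda ^+ #|` K1| * (\1_A (fill K1) * specification lambda L (fill
  K1) J) *
    weight lambda L (fill K1) K2)); last first.
  move=> K2; rewrite fpowersetE => K2L; rewrite wE // -/(fill _) AE //.
  by rewrite (specification_same_off _ _ (fillE _ K2L)) mulrAC.
rewrite -mulr_sumr -!mulrA; congr (_ * (_ * _)).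
rewrite -/(partition_function lambda L (fill K1)).
(* If this partition function vanishes, the specification is 0 because [0^-1 = 0], and the weight of
   [J], one of its nonnegative terms, vanishes as well. *)
have [Z_eq0|Z_neq0] := eqVneq (partition_function lambda L (fill K1)) 0;
  last by rewrite mulVf // mulr1.
rewrite Z_eq0 mulr0 mulr0; apply/eqP; rewrite eq_le weight_ge0 ?(ltW l0) // andbT -Z_eq0.
rewrite /partition_function (big_fsetD1 J) /= ?fpowersetE // lerDl.
by apply: sumr_ge0 => K _; apply: weight_ge0; apply: ltW.
Qed.
End FiniteVolume.

(** * Limits of finite-volume measures *)

Definition cylinder (A : set (set site)) : Prop := exists S, determined_on S A.

Lemma determined_on_sub (S S' : {fset site}) A : (S `<=` S')%fset -> determined_on S A ->
  determined_on S' A.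
Proof.
move=> SS oA I I' II'; apply: oA; apply/seteqP; split=> x [Ix xS]; split=> //.
  have : (I `&` [set` S']) x by split=> //; apply: (fsubsetP SS).
  by rewrite II' => -[].
have : (I' `&` [set` S']) x by split=> //; apply: (fsubsetP SS).
by rewrite -II' => -[].
Qed.

Lemma cylinder0 : cylinder set0.
Proof. by exists fset0. Qed.

Lemma cylinderC A : cylinder A -> cylinder (~` A).
Proof. by case=> S oA; exists S => I I' /esym II' nA /(oA _ _ II'). Qed.

Lemma cylinderU A B : cylinder A -> cylinder B -> cylinder (A `|` B).
Proof.
move=> [S oA] [S' oB]; exists (S `|` S')%fset => I I' II' [Ai|Bi]; [left|right].
  exact: (determined_on_sub (fsubsetUl S S') oA) II' Ai.
exact: (determined_on_sub (fsubsetUr S S') oB) II' Bi.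
Qed.

Lemma cylinder_occupied x : cylinder (occupied x).
Proof.
exists [fset x]%fset => I I' /seteqP[h _] Ix.
by have [] : (I' `&` [set` [fset x]%fset]) x by apply: h; split=> //=; rewrite inE.
Qed.

(** If no finite subfamily sufficed, an ultrafilter would contain all the remainders [B N]. Its
    pointwise limit [I0] belongs to every cylinder of the ultrafilter, hence to the union and to no
    [F k]. *)
Lemma cylinder_compact (F : nat -> set (set site)) :
  (forall i, cylinder (F i)) -> cylinder (\bigcup_i F i) ->
  exists N, \bigcup_i F i `<=` \bigcup_(i in [set i | (i < N)%N]) F i.
Proof.
move=> cF cU; apply: contrapT => nN.
pose B N := \bigcup_i F i `\` \bigcup_(i in [set i | (i < N)%N]) F i.
have B0 N : B N !=set0.
  by apply/set0P/negP => /eqP; rewrite /B setD_eq0 => h; apply: nN; exists N.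
have BI M N : B (maxn M N) `<=` B M `&` B N.
  move=> I [UI nI]; split; split=> // -[i /= iM Fi]; apply: nI; exists i => //=;
    by rewrite leq_max iM ?orbT.
have BF : ProperFilter (filter_from setT B).
  apply: filter_from_proper; last by move=> N _; exact: B0.
  by apply: filter_from_filter => [|M N _ _]; [exists 0%N|exists (maxn M N)].
have [V [UV BV]] := ultraFilterLemma BF.
pose I0 : set site := [set x | V (occupied x)].
have agree (s : seq site) : V [set I | forall x, x \in s -> (I x <-> I0 x)].
  elim: s => [|x s IHs]; first by apply: filterS filterT => I _ x; rewrite in_nil.
  have Vx : V [set I | I x <-> I0 x].
    have [Vx|Vx] := in_ultra_setVsetC (occupied x) UV.
      by apply: filterS (Vx) => I Ix; split=> _; [exact: Vx|exact: Ix].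
    apply: filterS (Vx) => I nIx; split=> [/nIx//|I0x].
    have : V (occupied x `&` ~` occupied x) by apply: filterI.
    by rewrite setICr => /filter_not_empty.
  apply: filterS (filterI Vx IHs) => I [Ix Is] y; rewrite inE => /orP[/eqP->//|].
  exact: Is.
have inV C : cylinder C -> V C -> C I0.
  move=> [S oC] VC; have [I [CI aI]] := filter_ex (filterI VC (agree S)).
  apply: oC CI; apply/seteqP; split=> x [h xS]; split=> //; exact/(aI x xS).
have VB N : V (B N) by apply: BV; exists N.
have [k _ Fk] : (\bigcup_i F i) I0 by apply: inV => //; apply: filterS (VB 0%N) => I [].
suff : (~` F k) I0 by exact.
apply: inV; first exact: cylinderC.
by apply: filterS (VB k.+1) => I [_ nI] Fi; apply: nI; exists k => //; exact: ltnSn.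
Qed.

(** The image has a cluster point by compactness of [0, 1], and a cluster point of an ultrafilter is
    a limit. *)
Lemma ultra_cvg_bounded (R : realType) (U : set_system nat) (u : nat -> R) :
  UltraFilter U -> (forall n, 0 <= u n <= 1) -> exists l : R, u n @[n --> U] --> l.
Proof.
move=> UU u01.
have uF : ProperFilter (u @ U) by exact: fmap_proper_filter.
have [|l [_ cl]] := @segment_compact R 0 1 (u @ U) uF.
  by have : U (u @^-1` `[0, 1]) by apply: filterS filterT => n _ /=; rewrite in_itv /=; exact: u01.
exists l => A nA; have [//|UA] := in_ultra_setVsetC (u @^-1` A) UU.
by have [x [nx Ax]] := cl (~` A) A UA nA.
Qed.

HB.instance Definition _ := Pointed.on (set site).
(* A copy of the configurations that carries the algebra of cylinders, [config] being already
   equipped with the generated sigma-algebra. *)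
Definition cylinder_type : Type := set site.
HB.instance Definition _ := Pointed.on cylinder_type.
HB.instance Definition _ := @isAlgebraOfSets.Build default_measure_display cylinder_type
  cylinder cylinder0 cylinderU cylinderC.

Section Ultralimit.
Variables (R : realType) (U : set_system nat) (P : nat -> set (set site) -> R).
Hypotheses (UU : UltraFilter U) (P_ge0 : forall n A, 0 <= P n A) (PT : forall n, P n setT = 1)
  (PU : forall n A B, A `&` B = set0 -> P n (A `|` B) = P n A + P n B).

Definition ulim (A : set (set site)) : R := lim (P n A @[n --> U]).

Lemma ulim_cvg A : P n A @[n --> U] --> ulim A.
Proof.
have P_le1 n B : P n B <= 1 by rewrite -(PT n) -(setUv B) PU ?setICr // lerDl.
have [l Pl] := ultra_cvg_bounded UU (fun n => introT andP (conj (P_ge0 n A) (P_le1 n A))).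
by rewrite /ulim (cvg_lim _ Pl).
Qed.

Lemma ulimE A l : P n A @[n --> U] --> l -> ulim A = l.
Proof. exact: cvg_lim. Qed.

Lemma ulim_ge0 A : 0 <= ulim A.
Proof. by apply: limr_ge; [apply/cvg_ex; exists (ulim A);
  exact: ulim_cvg|apply: filterS filterT => n _]. Qed.

Lemma ulimT : ulim setT = 1.
Proof. by apply: ulimE; under eq_cvg do rewrite PT; exact: cvg_cst. Qed.

Lemma ulimU A B : A `&` B = set0 -> ulim (A `|` B) = ulim A + ulim B.
Proof.
move=> AB; apply: ulimE; under eq_cvg do rewrite PU //.
by apply: cvgD; exact: ulim_cvg.
Qed.

Lemma ulim0 : ulim set0 = 0.
Proof. by apply: (addIr (ulim set0)); rewrite -ulimU ?setI0 // setU0 add0r. Qed.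

Let pre (A : set cylinder_type) : \bar R := (ulim A)%:E.

Let pre0 : pre set0 = 0%E. Proof. by rewrite /pre ulim0. Qed.
Let pre_ge0 A : (0 <= pre A)%E. Proof. by rewrite lee_fin ulim_ge0. Qed.

(** By compactness a disjoint sequence of cylinders whose union is a cylinder covers it after
    finitely many terms, so the partial sums are eventually constant. *)
Let pre_sigma_additive : semi_sigma_additive pre.
Proof.
move=> F cF tF cU; have [N FN] := cylinder_compact cF cU.
apply: cvg_near_cst; exists N => // n /= Nn.
have fin_add k : (\sum_(0 <= i < k) pre (F i) = pre (\big[setU/set0]_(i < k) F i))%E.
  elim: k => [|k IHk]; first by rewrite big_nil big_ord0 pre0.
  rewrite big_nat_recr //= IHk big_ord_recr /= /pre ulimU //.
  rewrite setIC; apply/seteqP; split=> // x [Fk]; rewrite -bigcup_mkord => -[i /= ik Fi].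
  have : (F i `&` F k) !=set0 by exists x.
  by move/tF => /(_ I I) ki; rewrite ki ltnn in ik.
rewrite fin_add; congr pre; rewrite -bigcup_mkord; apply/seteqP; split.
  by move=> x [i _ Fi]; exists i.
by move=> x /FN[i /= iN Fi]; exists i => //=; apply: leq_trans iN Nn.
Qed.

HB.instance Definition _ := isMeasure.Build _ cylinder_type R pre pre0 pre_ge0 pre_sigma_additive.

(** The Caratheodory extension, viewed on the sigma-algebra of [config]; the generators of the
    latter are cylinders. *)
Let ext (A : set config) : \bar R := measure_extension pre A.

Let config_measurable (A : set config) : measurable A ->
  (@measurable _ cylinder_type).-sigma.-measurable A.
Proof.
apply: sub_sigma_algebra2 => _ [x _ <-]; exact: cylinder_occupied.
Qed.

Let ext0 : ext set0 = 0%E. Proof. exact: measure0. Qed.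
Let ext_ge0 A : (0 <= ext A)%E. Proof. exact: measure_ge0. Qed.
Let ext_sigma_additive : semi_sigma_additive ext.
Proof.
move=> F mF tF mU; apply: (measure_semi_sigma_additive (s := measure_extension pre)) => //.
  by move=> i; apply: config_measurable.
exact: config_measurable.
Qed.
HB.instance Definition _ := isMeasure.Build _ config R ext ext0 ext_ge0 ext_sigma_additive.

Let ext_cylinder A : cylinder A -> ext A = (ulim A)%:E.
Proof. by move=> cA; rewrite /ext /measure_extension measurable_mu_extE. Qed.

Let extT : ext setT = 1%E.
Proof. by rewrite ext_cylinder ?ulimT //; exists fset0. Qed.
HB.instance Definition _ := Measure_isProbability.Build _ _ _ ext extT.

Lemma ultralimit_measure :
  exists mu : probability config R, forall A, cylinder A -> mu A = (ulim A)%:E.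
Proof. by exists ext; exact: ext_cylinder. Qed.
End Ultralimit.

(** * Gibbs states *)

(** Induction on the sites of [S]: the event is split by the state of one site [x], and each half is
    [occupied x] or its complement intersected with an event that the other sites determine. *)
Lemma determined_on_sigma (X : set site) (S : {fset site}) A :
  [set` S] `<=` X -> determined_on S A -> <<s occupied @` X >> A.
Proof.
have sA : sigma_algebra setT <<s occupied @` X >> by exact: smallest_sigma_algebra.
pose T := g_sigma_algebraType (occupied @` X).
have mE (B : set T) : measurable B <-> <<s occupied @` X >> B by [].
suff main (s : seq site) : (forall x, x \in s -> X x) -> forall B : set (set site),
    (forall I I', (forall x, x \in s -> I x <-> I' x) -> B I -> B I') -> measurable (B : set T).
  move=> SX oA; apply/mE; apply: (main S) => [x|I I' II' AI]; first exact: SX.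
  by apply: oA AI; apply/seteqP; split=> x [h xS]; split=> //; apply/(II' x xS).
elim: s => [|x s IHs] sX B oB.
  have [[I0 BI0]|nB] := pselect (exists I, B I).
    rewrite (_ : B = setT); first exact: measurableT.
    by apply/seteqP; split=> // I _; apply: oB BI0.
  rewrite (_ : B = set0); first exact: measurable0.
  by apply/seteqP; split=> // I BI; apply: nB; exists I.
have IHs' := IHs (fun y ys => sX y (@mem_behead _ (x :: s) y ys)).
pose B1 := [set I | B (I `|` [set x])]; pose B0 := [set I | B (I `\` [set x])].
have oB1 I I' : (forall y, y \in s -> I y <-> I' y) -> B1 I -> B1 I'.
  move=> II'; apply: oB => y; rewrite inE => /orP[/eqP->|ys]; first by split=> _; right.
  by split=> -[h|h]; [left; apply/II'|right|left; apply/II'|right].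
have oB0 I I' : (forall y, y \in s -> I y <-> I' y) -> B0 I -> B0 I'.
  move=> II'; apply: oB => y; rewrite inE => /orP[/eqP->|ys]; first by split=> -[_ []].
  by split=> -[h nx]; split=> //; apply/II'.
have mx : measurable (occupied x : set T).
  by apply: sub_sigma_algebra; exists x => //; apply: sX; exact: mem_head.
rewrite (_ : B = (occupied x `&` B1) `|` (~` occupied x `&` B0)).
  apply: measurableU; apply: measurableI.
  - exact: mx.
  - exact: IHs' oB1.
  - exact: measurableC.
  - exact: IHs' oB0.
have IU I : I x -> I `|` [set x] = I.
  by move=> Ix; apply/seteqP; split=> y; [case=> [//|->]|left].
have ID I : ~ I x -> I `\` [set x] = I.
  by move=> Ix; apply/seteqP; split=> y; [case|move=> Iy; split=> // yx; apply: Ix; rewrite -yx].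
apply/seteqP; split=> I.
  by have [Ix|Ix] := pselect (I x) => BI; [left|right]; split; rewrite // /B1 /B0 /= ?IU ?ID.
by case=> -[Ix]; rewrite /B1 /B0 /= ?IU ?ID.
Qed.

Lemma measurable_cylinder (A : set config) : cylinder A -> measurable A.
Proof. by case=> S oA; apply: (determined_on_sigma (X := setT) _ oA). Qed.

Lemma determined_on_pattern B K : determined_on B (pattern B K).
Proof. by move=> I I'; rewrite /pattern /= => ->. Qed.

Lemma cylinder_pattern B K : cylinder (pattern B K).
Proof. by exists B; exact: determined_on_pattern. Qed.

Lemma cylinderI A B : cylinder A -> cylinder B -> cylinder (A `&` B).
Proof.
by move=> cA cB; rewrite -(setCK (_ `&` _)) setCI; apply/cylinderC/cylinderU; exact: cylinderC.
Qed.

(** Numbering the pairs of sites by their codes makes the failure of independence a countable union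
    of cylinders. *)
Definition conflict (T : set site) (n : nat) : set (set site) :=
  if choice.unpickle n is Some (x, y) then [set I | [/\ neighbors x y,
    (I `\` T) x & (I `\` T) y]] else set0.

Lemma dependentE T : ~` [set I | independent (I `\` T)] = \bigcup_n conflict T n.
Proof.
apply/seteqP; split=> I.
  apply: contra_notP => nU x y Ix Iy xy; apply: nU.
  have := @choice.pickleK (int * int * (int * int))%type (x, y).
  by move: (choice.pickle _) => n xyn; exists n; rewrite // /conflict xyn.
case=> n _; rewrite /conflict; case: choice.unpickle => // -[x y] [xy Ix Iy] iI.
exact: iI Ix Iy xy.
Qed.

Lemma cylinder_conflict T n : cylinder (conflict T n).
Proof.
rewrite /conflict; case: choice.unpickle => [[x y]|]; last exact: cylinder0.
have cyl_off z : cylinder [set I | (I `\` T) z].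
  have [Tz|nTz] := pselect (T z).
    by rewrite (_ : [set I | _] = set0); [exact: cylinder0|apply/seteqP; split=> // I []].
  rewrite (_ : [set I | _] = occupied z); first exact: cylinder_occupied.
  by apply/seteqP; split=> I; [case|split].
have [xy|nxy] := pselect (neighbors x y); last first.
  by rewrite (_ : [set I | _] = set0); [exact: cylinder0|apply/seteqP; split=> // I []].
rewrite (_ : [set I | _] = [set I | (I `\` T) x] `&` [set I | (I `\` T) y]).
  exact: cylinderI.
by apply/seteqP; split=> I; [case|case].
Qed.

Lemma measurable_independent T : measurable ([set I | independent (I `\` T)] : set config).
Proof.
rewrite -(setCK [set I | _]) dependentE; apply/measurableC/bigcupT_measurable => n.
exact: measurable_cylinder (cylinder_conflict T n).
Qed.

Lemma cvg_sum_seq (R : realType) (T : Type) (F : set_system nat) (s : seq T) (u : T -> nat ->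
  R) (l : T -> R) :
  Filter F -> (forall t, u t n @[n --> F] --> l t) ->
  (\sum_(t <- s) u t n) @[n --> F] --> \sum_(t <- s) l t.
Proof.
move=> FF ul; elim: s => [|t s IHs].
  by rewrite big_nil; under eq_cvg do rewrite big_nil; exact: cvg_cst.
by rewrite big_cons; under eq_cvg do rewrite big_cons; exact: cvgD.
Qed.

Section Gibbs.
Variables (R : realType) (lambda : R) (p : bool).
Hypothesis l0 : 0 < lambda.

(** A form of the DLR equation with a number of terms that does not depend on [n], so that it passes
    to the limit term by term. *)
Lemma finite_gibbs_sum n L J A : (L `<=` box n)%fset -> (J `<=` L)%fset -> determined_off L A ->
  finite_gibbs lambda p n (A `&` pattern L J) =
  \sum_(K <- fpowerset (nbhd L)) specification lambda L [set` K] J *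
    finite_gibbs lambda p n (A `&` pattern (nbhd L) K).
Proof.
move=> Ln JL oA; rewrite finite_gibbs_dlr //.
have independentE (X : set (set site)) :
    finite_gibbs lambda p n X = finite_gibbs lambda p n (X `&` [set I | independent (I `\` [set`
      L])]).
  rewrite -{1}(setIT X) -(setUv [set I | independent (I `\` [set` L])]) setIUr finite_gibbsU.
    rewrite [X in _ + X]finite_gibbs_dependent ?addr0 // => I [_ nI] iI;
      apply: nI => x y [Ix _] [Iy _].
    exact: iI.
  by rewrite setIACA setICr setI0.
under [RHS]eq_bigr => K _ do rewrite independentE /finite_gibbs mulrA.
rewrite -mulr_suml; congr (_ / _).
under eq_bigr => K' _ do rewrite specification_sum // !mulr_sumr.
rewrite exchange_big /=; apply: eq_bigr => K _; rewrite mulr_sumr; apply: eq_bigr => K' _.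
by rewrite -setIA [in RHS]indicI /=; ring.
Qed.

Variables (U : set_system nat) (mu : probability config R).
Hypotheses (UU : UltraFilter U) (oU : \oo `<=` U)
  (muE : forall A, cylinder A -> mu A = (ulim U (finite_gibbs lambda p) A)%:E).

Let ulimP := ulim_cvg UU (@finite_gibbs_ge0 R lambda p l0) (@finite_gibbsT R lambda p l0)
  (@finite_gibbsU R lambda p).

(** Each conflict is a cylinder of probability 0 in every finite volume, hence also in the limit,
    and there are countably many of them. *)
Lemma limit_independent T : mu [set I | independent (I `\` T)] = 1%E.
Proof.
rewrite -(setCK [set I | _]) probability_setC; last by apply: measurableC;
  exact: measurable_independent.
rewrite (_ : mu _ = 0%E) ?sube0 // dependentE.
apply/negligibleP; first by apply: bigcupT_measurable => n;
  exact: measurable_cylinder (cylinder_conflict T n).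
apply: negligible_bigcup => n; apply/negligibleP;
  first exact: measurable_cylinder (cylinder_conflict T n).
apply: (eq_trans (muE (cylinder_conflict T n))).
have conflict0 k : finite_gibbs lambda p k (conflict T n) = 0.
  apply: finite_gibbs_dependent => I; rewrite /conflict;
    case: choice.unpickle => // -[x y] [xy [Ix _] [Iy _]] iI.
  exact: iI Ix Iy xy.
by congr _%:E; apply: ulimE; under eq_cvg do rewrite conflict0; exact: cvg_cst.
Qed.

Lemma limit_sum L J S A : determined_on S A -> [disjoint S & L]%fset -> (J `<=` L)%fset ->
  mu (A `&` pattern L J) =
  (\sum_(K <- fpowerset (nbhd L))
    (specification lambda L [set` K] J)%:E * mu (A `&` pattern (nbhd L) K))%E.
Proof.
move=> oA SL JL; have cA : cylinder A by exists S.
have cAp B K : cylinder (A `&` pattern B K) by apply: cylinderI => //; exact: cylinder_pattern.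
under eq_bigr => K _ do rewrite muE // -EFinM.
rewrite muE // sumEFin; congr _%:E; apply: ulimE.
have offA : determined_off L A.
  move=> I I' II'; apply: oA; apply/seteqP; split=> x [Ix xS]; split=> //;
    have nxL : ~ [set` L] x by [move/fdisjointP: SL => /(_ x xS) /negP].
    by have : (I `\` [set` L]) x by []; rewrite II' => -[].
  by have : (I' `\` [set` L]) x by []; rewrite -II' => -[].
have [N LN] := fset_in_box L.
apply: (cvg_trans (G := \sum_(K <- fpowerset (nbhd L)) specification lambda L [set` K] J *
    finite_gibbs lambda p n (A `&` pattern (nbhd L) K) @[n --> U])); last first.
  by apply: cvg_sum_seq => K; apply: cvgMr; exact: ulimP.
apply: near_eq_cvg; apply: oU; exists N => // n /= Nn; rewrite finite_gibbs_sum //.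
apply/fsubsetP => x /LN; rewrite mem_box /in_box => /andP[h1 h2].
by rewrite (leq_trans h1) ?(leq_trans h2).
Qed.

(** Both sides are finite measures in [E], and they agree on the cylinders over sites outside [L].
    These are stable under intersection and generate the outside events. *)
Lemma outside_unique L J E : (J `<=` L)%fset -> outside_event L E ->
  mu (E `&` pattern L J) =
  (\sum_(K <- fpowerset (nbhd L))
    (specification lambda L [set` K] J)%:E * mu (E `&` pattern (nbhd L) K))%E.
Proof.
move=> JL; pose G := [set A : set config | exists2 S, determined_on S A & [disjoint S & L]%fset].
have mpat B K : measurable (pattern B K : set config).
  exact: measurable_cylinder (cylinder_pattern B K).
pose c (K : {fset site}) := NngNum (specification_ge0 l0 L [set` K] J).
pose Ks := fpowerset (nbhd L); pose Kn i := nth fset0 Ks i.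
pose m1 := mrestr mu (mpat L J).
pose m2 := msum (fun i => mscale (c (Kn i)) (mrestr mu (mpat (nbhd L) (Kn i)))) (size Ks).
have m2E A : m2 A = (\sum_(K <- Ks) (specification lambda L [set` K] J)%:E *
    mu (A `&` pattern (nbhd L) K))%E.
  by rewrite [RHS](big_nth fset0) big_mkord.
have GI : setI_closed G.
  move=> A B [S oA SL] [S' oB S'L]; exists (S `|` S')%fset; last by rewrite fdisjointUX SL.
  move=> I I' II' [AI BI]; split.
    exact: (determined_on_sub (fsubsetUl S S') oA) II' AI.
  exact: (determined_on_sub (fsubsetUr S S') oB) II' BI.
move=> oE; rewrite -m2E -[LHS]/(m1 E).
apply: (@g_sigma_algebra_measure_unique _ R config G _ (fun=> setT)) => //.
- by move=> A [S oA _]; apply: measurable_cylinder; exists S.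
- by move=> _; exists fset0 => //; apply/fdisjointP => x; rewrite in_fset0.
- by rewrite bigcup_const.
- by move=> A [S oA SL]; apply: (eq_trans (limit_sum oA SL JL)); exact: esym (m2E A).
- by move=> _; rewrite /m1 /mrestr /=; apply: fin_num_fun_lty; exact: fin_num_measure.
apply: sub_sigma_algebra2 oE => _ [x xL <-]; exists [fset x]%fset.
  move=> I I' /seteqP[h _] Ix.
  by have [] : (I' `&` [set` [fset x]%fset]) x by apply: h; split=> //=; rewrite inE.
by rewrite fdisjoint1X; apply/negP.
Qed.

(** Integrating the finite expansion of the specification gives the sum in [outside_unique], because
    independence outside [L] has probability 1. *)
Lemma limit_dlr L J A : (J `<=` L)%fset -> outside_event L A ->
  mu (A `&` pattern L J) = (\int[mu]_(I in A) (specification lambda L I J)%:E)%E.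
Proof.
move=> JL oA; have mA : measurable (A : set config).
  by apply: sub_sigma_algebra2 oA => _ [x _ <-]; exists x.
pose ind : set config := [set I | independent (I `\` [set` L])].
have mC K : measurable (pattern (nbhd L) K `&` ind : set config).
  apply: measurableI; first exact: measurable_cylinder (cylinder_pattern _ _).
  exact: measurable_independent.
rewrite outside_unique //.
under [RHS]eq_integral => I _ do rewrite specification_sum // -sumEFin.
rewrite ge0_integral_sum //; first last.
- by move=> K I _; rewrite lee_fin mulr_ge0 // specification_ge0.
- by move=> K; apply/measurable_EFinP; apply: measurable_funM => //.
apply: eq_bigr => K _; under [RHS]eq_integral => I _ do rewrite EFinM.
rewrite ge0_integralZl_EFin //; first last.
- exact: specification_ge0.
- by apply/measurable_EFinP; exact: (@measurable_indic _ config R A _ (mC K)).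
rewrite integral_indic //; congr (_ * _)%E.
have mp : measurable (pattern (nbhd L) K : set config).
  exact: measurable_cylinder (cylinder_pattern _ _).
have mind : measurable ind by exact: measurable_independent.
have mAp : measurable (A `&` pattern (nbhd L) K) by exact: measurableI.
have nind : mu (~` ind) = 0%E by rewrite probability_setC // limit_independent subee.
rewrite (measureDI mu mAp mind) (@subset_measure0 _ _ _ mu _ (~` ind)) //.
- by rewrite add0e -setIA [A `&` _]setIC.
- exact: measurableD.
- exact: measurableC.
Qed.
End Gibbs.

(** * Comparison of two neighbouring segments *)

Definition contains (S : {fset site}) : set (set site) := [set I | [set` S] `<=` I].

Lemma cylinder_contains S : cylinder (contains S).
Proof.
exists S => I I' /seteqP[II' _] SI x xS.
by have [] : (I' `&` [set` S]) x by apply: II'; split=> //; apply: SI.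
Qed.

Lemma independent_par (S : set site) q : (forall x, S x -> parity x = q) -> independent S.
Proof. by move=> Sq x y Sx Sy /parity_neighbors; rewrite !Sq //; case: (q). Qed.

Lemma parity_diag a i : parity (diag a i) = parity a.
Proof. by rewrite /parity /diag; case: a => a1 a2 /=; lia. Qed.

Section InfiniteVolume.
Variables (R : realType) (lambda : R) (p : bool).
Hypothesis l0 : 0 < lambda.

Lemma finite_gibbs_peierls m a d : parity a = ~~ p -> d \in dirs ->
  (forall Ds : seq {fset site}, uniq Ds -> {in Ds, forall D, contour p a m D} ->
    \sum_(D <- Ds) (1 + lambda) ^- count_dir D d <= 2^-1) ->
  \forall n \near \oo, finite_gibbs lambda p n (contains (diag_fset a m)) <=
    2^-1 * finite_gibbs lambda p n (contains (diag_fset (a + rotl d) m)).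
Proof.
move=> pa dd hsum; have [N SN] := fset_in_box (diag_fset a m `|` diag_fset (a + rotl d)%R m)%fset.
exists N => // n /= Nn; rewrite /finite_gibbs mulrA ler_pM2r; last first.
  by rewrite invr_gt0; apply: partition_function_gt0 => //; apply: independent_ground_state.
(* Once the box contains both segments, the filled configuration contains a segment exactly when [J]
   does. *)
have fvE b : (diag_fset b m `<=` diag_fset a m `|` diag_fset (a + rotl d)%R m)%fset ->
    \sum_(J <- fpowerset (box n)) weight lambda (box n) (ground_state p) J *
      \1_(contains (diag_fset b m)) (filling (box n) (ground_state p) J) =
    \sum_(J <- fpowerset (box n) | (diag_fset b m `<=` J)%fset) weight lambda (box n) (ground_state
      p) J.
  move=> bS; rewrite [RHS]big_mkcond; apply: eq_big_seq => J; rewrite fpowersetE => Jn.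
  have bn x : x \in diag_fset b m -> x \in box n.
    move=> /(fsubsetP bS)/SN; rewrite mem_box /in_box => /andP[h1 h2].
    by rewrite (leq_trans h1) ?(leq_trans h2).
  rewrite indicE; case: ifPn => bJ.
    rewrite mem_set ?mulr1 // => x xb; left; exact: (fsubsetP bJ).
  rewrite memNset ?mulr0 // => sub; case/negP: bJ; apply/fsubsetP => x xb.
  by case: (sub x xb) => // -[_ /= xn]; case: xn; apply: bn.
rewrite !fvE ?fsubsetUl ?fsubsetUr //.
by apply: peierls => //; exact: ltW.
Qed.

Lemma limit_gibbs : exists mu : probability config R,
  [/\ gibbs_state lambda mu,
      forall A B : set (set site), cylinder A -> cylinder B ->
        (\forall n \near \oo, finite_gibbs lambda p n A <= 2^-1 * finite_gibbs lambda p n B) ->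
        fine (mu A) <= 2^-1 * fine (mu B)
    & forall (S : {fset site}) q, {in S, forall x, parity x = q} -> 0 < fine (mu (contains S))].
Proof.
(* As [U] refines the filter at infinity, inequalities valid in all large boxes pass to the
   limit. *)
have [U [UU oU]] := ultraFilterLemma eventually_filter.
have ulimP := ulim_cvg UU (@finite_gibbs_ge0 R lambda p l0) (@finite_gibbsT R lambda p l0)
  (@finite_gibbsU R lambda p).
have [mu muE] := ultralimit_measure UU (@finite_gibbs_ge0 R lambda p l0) (@finite_gibbsT R lambda p
  l0) (@finite_gibbsU R lambda p).
exists mu; split.
- split; last by move=> L J A; exact: (limit_dlr l0 UU oU muE).
  rewrite -(limit_independent UU muE set0); congr (mu _).
  by apply/seteqP; split=> I /=; rewrite setD0.
- move=> A B cA cB AB; rewrite !muE //=.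
  have limB : 2^-1 * finite_gibbs lambda p n B @[n --> U] --> 2^-1 * ulim U (finite_gibbs lambda p)
    B.
    by apply: cvgMr; exact: ulimP.
  by apply: (ler_cvg_to (ulimP A) limB); exact: oU.
(* Finite energy: vacating the neighbours of [S] decouples it from the outside, so the pattern [S]
   on [L] has positive conditional probability given any independent pattern around [L]. *)
- move=> S q Sq; pose L := (S `|` nbhd S)%fset.
  have SL : (S `<=` L)%fset by exact: fsubsetUl.
  have muS : mu (contains S) = (ulim U (finite_gibbs lambda p) (contains S))%:E.
    by apply: muE; exact: cylinder_contains.
  have cpat B K : cylinder (pattern B K) by exact: cylinder_pattern.
  have lsum : ulim U (finite_gibbs lambda p) (pattern L S) = \sum_(K <- fpowerset (nbhd L))
      specification lambda L [set` K] S * ulim U (finite_gibbs lambda p) (pattern (nbhd L) K).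
    have onT : determined_on fset0 [set: set site] by [].
    have := limit_sum l0 UU oU muE onT (fdisjoint0X L) SL; rewrite setTI muE //.
    by under eq_bigr => K _ do rewrite setTI muE // -EFinM; rewrite sumEFin => -[].
  have tot : \sum_(K <- fpowerset (nbhd L)) ulim U (finite_gibbs lambda p) (pattern (nbhd L) K) = 1.
    have h : \sum_(K <- fpowerset (nbhd L)) finite_gibbs lambda p n (pattern (nbhd L) K) @[n --> U]
      -->
        \sum_(K <- fpowerset (nbhd L)) ulim U (finite_gibbs lambda p) (pattern (nbhd L) K).
      by apply: cvg_sum_seq => K; exact: ulimP.
    rewrite -(cvg_lim _ h) //; apply/cvg_lim => //.
    have sum1 n : \sum_(K <- fpowerset (nbhd L)) finite_gibbs lambda p n (pattern (nbhd L) K) = 1.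
      rewrite -(finite_gibbsT p l0 n) /finite_gibbs -mulr_suml exchange_big /=; congr (_ / _).
      apply: eq_bigr => J _; rewrite indicT mulr1.
      have [K KB IK] := pattern_exists (nbhd L) (filling (box n) (ground_state p) J).
      exact: (sum_pattern (fun=> weight lambda (box n) (ground_state p) J) KB IK).
    by under eq_cvg do rewrite sum1; exact: cvg_cst.
  have ulim_ge0' A : 0 <= ulim U (finite_gibbs lambda p) A.
    exact: (ulim_ge0 UU (@finite_gibbs_ge0 R lambda p l0) (@finite_gibbsT R lambda p l0)
      (@finite_gibbsU R lambda p)).
  have spec_gt0 K : (K `<=` nbhd L)%fset -> independent [set` K] ->
      0 < specification lambda L [set` K] S.
    move=> KL iK; have iKL : independent ([set` K] `\` [set` L]).
      by move=> x y [Kx _] [Ky _]; exact: iK.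
    rewrite divr_gt0 ?partition_function_gt0 // /weight -/(filling _ _ _) asboolT ?exprn_gt0 //.
    have iS : independent [set` S] by apply: (@independent_par _ q); exact: Sq.
    have sep x y : x \in S -> ([set` K] `\` [set` L]) y -> ~ neighbors x y.
      move=> xS [/= yK yL] xy; apply: yL; rewrite /= in_fsetU.
      have [//|yS /=] := boolP (y \in S); by apply/mem_nbhd; split=> //; exists x.
    move=> x y [/= xS|xK] [/= yS|yK] xy.
    + exact: iS xS yS xy.
    + exact: sep xS yK xy.
    + exact: sep yS xK (neighbors_sym xy).
    + exact: iKL xK yK xy.
  have ulim_dep K : ~ independent [set` K] ->
    ulim U (finite_gibbs lambda p) (pattern (nbhd L) K) = 0.
    move=> nK; apply: ulimE.
    have conflict0 n : finite_gibbs lambda p n (pattern (nbhd L) K) = 0.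
      apply: finite_gibbs_dependent => I IK iI; apply: nK; rewrite -IK => x y [Ix _] [Iy _];
        exact: iI.
    by under eq_cvg do rewrite conflict0; exact: cvg_cst.
  have pos : 0 < ulim U (finite_gibbs lambda p) (pattern L S).
    (* Otherwise every independent pattern around [L] would have probability 0, as the dependent
       ones do, whereas the total is 1. *)
    rewrite lt_neqAle ulim_ge0' andbT; apply/eqP => /esym pat0.
    have : \sum_(K <- fpowerset (nbhd L)) ulim U (finite_gibbs lambda p) (pattern (nbhd L) K) = 0.
      rewrite big_seq big1 // => K Kin; have := Kin; rewrite fpowersetE => KL.
      have [iK|/ulim_dep//] := pselect (independent [set` K]).
      apply/eqP; rewrite -(mulrI_eq0 _ (lregP (lt0r_neq0 (spec_gt0 K KL iK)))).
      move: lsum; rewrite pat0 (big_fsetD1 K) //= => /esym/eqP.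
      rewrite paddr_eq0 => [/andP[]//||]; first by rewrite mulr_ge0 ?specification_ge0.
      by apply: sumr_ge0 => M _; rewrite mulr_ge0 ?specification_ge0.
    by rewrite tot => /eqP; rewrite oner_eq0.
  rewrite muS /=; apply: lt_le_trans pos _.
  have sub : pattern L S `<=` contains S.
    by move=> I IS x xS; have [] : (I `&` [set` L]) x by rewrite IS.
  have -> : contains S = pattern L S `|` (contains S `\` pattern L S) by rewrite setDUK.
  rewrite (ulimU UU (@finite_gibbs_ge0 R lambda p l0) (@finite_gibbsT R lambda p l0)
    (@finite_gibbsU R lambda p)) ?lerDl //.
  by apply/seteqP; split=> // I [? []].
Qed.
End InfiniteVolume.

Theorem theorem1p1 (R : realType) (lambda : R)
    (hlambda : 5 + 3646 / 10 ^+ 4 < lambda) :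
  exists mu nu : probability config R,
    [/\ gibbs_state lambda mu, gibbs_state lambda nu
      & exists2 A : set config, measurable A & mu A <> nu A].
Proof.
have l0 : 0 < lambda by lra.
have [m hm] := contour_sum hlambda.
have [mu [gmu mu_le mu_pos]] := limit_gibbs true l0.
have [nu [gnu nu_le nu_pos]] := limit_gibbs false l0.
(* The segments have opposite parities and are exchanged by horizontal unit shifts, [rotl (0, -1)]
   and [rotl (0, 1)]. The odd boundary condition disfavours the even [S0], the even one disfavours
   the odd [S1]. *)
pose S0 := diag_fset (0, 0) m; pose S1 := diag_fset (1, 0) m.
have mu01 : fine (mu (contains S0)) <= 2^-1 * fine (mu (contains S1)).
  apply: mu_le; [exact: cylinder_contains|exact: cylinder_contains|].
  have := @finite_gibbs_peierls R lambda true l0 m (0, 0) (0, -1) erefl erefl.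
  by apply => Ds; apply: hm.
have nu10 : fine (nu (contains S1)) <= 2^-1 * fine (nu (contains S0)).
  apply: nu_le; [exact: cylinder_contains|exact: cylinder_contains|].
  have := @finite_gibbs_peierls R lambda false l0 m (1, 0) (0, 1) erefl erefl.
  by apply => Ds; apply: hm.
have pos : 0 < fine (mu (contains S0)).
  by apply: (mu_pos _ (parity (0, 0))) => x; rewrite in_fset => /mapP[i _ ->]; exact: parity_diag.
have measurable_contains S : measurable (contains S : set config).
  exact: measurable_cylinder (cylinder_contains S).
exists mu, nu; split=> //.
have [eq0|ne0] := pselect (mu (contains S0) = nu (contains S0)); last by exists (contains S0).
have [eq1|ne1] := pselect (mu (contains S1) = nu (contains S1)); last by exists (contains S1).
(* If the two states agreed on both events, the probability of [S0] would be at most a quarter of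
   itself, although it is positive. *)
by move: mu01 nu10 pos; rewrite -eq0 -eq1; lra.
Qed.
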